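(* Let $Y_{t,T} = m_T(t/T)+\varepsilon_t$ for $1\le t\le T$, where each $m_T:[0,1]\to\mathbb{R}$ is continuously differentiable, and let $\{\varepsilon_t\}$, $K$, $\mathcal{G}_T$, $h_{\min},h_{\max}$ satisfy conditions (C1)--(C6) listed in the context. Let $\sigma^2=\sum_{\ell=-\infty}^\infty \mathrm{Cov}(\varepsilon_0,\varepsilon_\ell)>0$ and let $\widehat\sigma^2$ be an estimator of $\sigma^2$ with $\widehat\sigma^2=\sigma^2+o_p(\rho_T)$, where $\rho_T=o(1/\log T)$. Let $$\widehat\Psi_T=\max_{(u,h)\in\mathcal{G}_T}\Big\{\Big|\frac{\widehat\psi_T(u,h)}{\widehat\sigma}\Big|-\lambda(h)\Big\},\qquad \widehat\psi_T(u,h)=\sum_{t=1}^Tw_{t,T}(u,h)Y_{t,T},$$ and, for $\alpha\in(0,1)$, let $q_T(\alpha)$ be the $(1-\alpha)$-quantile of $$\Phi_T=\max_{(u,h)\in\mathcal{G}_T}\Big\{\Big|\sum_{t=1}^T w_{t,T}(u,h)Z_t\Big|-\lambda(h)\Big\},$$ with $Z_t$ independent standard normal. Suppose that there is a sequence of positive numbers $c_T\to\infty$ such that for each $T$ there exists $(u,h)=(u_T,h_T)\in\mathcal{G}_T$ with $[u-h,u+h]\subseteq[0,1]$ and $$m_T'(w)\ge c_T\sqrt{\frac{\log T}{Th^3}}\quad\text{for all } w\in[u-h,u+h]$$ (or, alternatively, $-m_T'(w)\ge c_T\sqrt{\log T/(Th^3)}$ for all $w\in[u-h,u+h]$). Then,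 as $T\to\infty$, $$\mathbb{P}\big(\widehat\Psi_T\le q_T(\alpha)\big)=o(1).$$
   Context: Setting: $\{\varepsilon_t\}$ is a stationary process with $\mathbb{E}[\varepsilon_t]=0$; $T$ is the sample size and all asymptotics are for $T\to\infty$. An estimator $\widehat\sigma^2$ is a measurable function of the data $Y_{1,T},\dots,Y_{T,T}$; $\rho_T>0$ is a deterministic sequence. For a random variable $X$, $\|X\|_q=(\mathbb{E}|X|^q)^{1/q}$. Conditions: (C1) $\varepsilon_t=G(\ldots,\eta_{t-1},\eta_t,\eta_{t+1},\ldots)$ with i.i.d. random variables $\eta_t$ ($t\in\mathbb{Z}$) and a measurable $G:\mathbb{R}^{\mathbb{Z}}\to\mathbb{R}$. (C2) $\|\varepsilon_t\|_q<\infty$ for some $q>4$. (C3) Let $\{\eta_t'\}$ be an i.i.d. copy of $\{\eta_t\}$, $\varepsilon_t'=G(\ldots,\eta_{-1},\eta_0',\eta_1,\ldots,\eta_{t-1},\eta_t,\eta_{t+1},\ldots)$ (only $\eta_0$ is replaced by $\eta_0'$), $d_{t,q}=\|\varepsilon_t-\varepsilon_t'\|_q$ and $\Theta_{t,q}=\sum_{|s|\ge t}d_{s,q}$ for $t\ge0$. It holds that $\Theta_{t,q}=O(t^{-\tau_q}(\log t)^{-A})$, where $A>\frac23(1/q+1+\tau_q)$ and $\tau_q=\frac{q^2-4+(q-2)\sqrt{q^2+20q+4}}{8q}$. (C4) The kernel $K$ is non-negative, symmetric about zero, integrates to one, has compact support $[-1,1]$ and is Lipschitz continuous: $|K(v)-K(w)|\le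 C|v-w|$ for all $v,w\in\mathbb{R}$ and some constant $C>0$. (C5) $|\mathcal{G}_T|=O(T^\theta)$ for some arbitrarily large but fixed constant $\theta>0$, where $|\mathcal{G}_T|$ is the cardinality of $\mathcal{G}_T$. (C6) $h_{\min}/\{T^{-(1-2/q)}\log T\}\to\infty$ with $q$ from (C2), and $h_{\max}<1/2$. Here $\mathcal{G}_T$ is a (nonempty) subset of $\{(u,h): u=t/T \text{ for some }1\le t\le T,\ h\in[h_{\min},h_{\max}]\}$, and $h_{\min},h_{\max}$ may depend on $T$. Weights: $w_{t,T}(u,h)=\Lambda_{t,T}(u,h)\big/\{\sum_{s=1}^T\Lambda_{s,T}(u,h)^2\}^{1/2}$ with $$\Lambda_{t,T}(u,h)=K\Big(\frac{t/T-u}{h}\Big)\Big[S_{T,0}(u,h)\Big(\frac{t/T-u}{h}\Big)-S_{T,1}(u,h)\Big],\quad S_{T,\ell}(u,h)=\frac1{Th}\sum_{t=1}^TK\Big(\frac{t/T-u}{h}\Big)\Big(\frac{t/T-u}{h}\Big)^\ell .$$ Correction term: $\lambda(h)=\sqrt{2\log\{1/(2h)\}}$. *)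

(* Defs.v *)
From HB Require Import structures.
From mathcomp Require Import all_boot all_order all_algebra finmap.
From mathcomp Require Import all_classical all_reals all_analysis.

Set Implicit Arguments.
Unset Strict Implicit.
Unset Printing Implicit Defensive.

Import Order.TTheory GRing.Theory Num.Theory.
Import numFieldNormedType.Exports.

Local Open Scope classical_set_scope.
Local Open Scope ring_scope.

Section Probability.
Context {d : measure_display} {Omega : measurableType d} {R : realType}.
Implicit Type P : probability Omega R.

Definition mutually_independent P (I : choiceType) (X : I -> {RV P >-> R}) : Prop :=
  forall (J : {fset I}) (A : I -> set R),
    (forall i, i \in J -> measurable (A i)) ->
    P (\bigcap_(i in [set` J]) (X i @^-1` A i)) =
    (\prod_(i <- J) P (X i @^-1` A i))%E.

Definition identically_distributed P (I : Type) (X : I -> {RV P >-> R}) : Prop :=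
  forall (i j : I) (A : set R), measurable A ->
    distribution P (X i) A = distribution P (X j) A.

Definition iid P (I : choiceType) (X : I -> {RV P >-> R}) : Prop :=
  mutually_independent X /\ identically_distributed X.

(* X' is an independent copy of the i.i.d. family X: all the variables of both
   families together are i.i.d. *)
Definition iid_copy P (I : choiceType) (X X' : I -> {RV P >-> R}) : Prop :=
  iid (fun s : I + I => match s with inl i => X i | inr i => X' i end).

Definition standard_normal P (X : {RV P >-> R}) : Prop :=
  forall A : set R, measurable A -> distribution P X A = normal_prob 0 1 A.

Definition strictly_stationary P (X : int -> {RV P >-> R}) : Prop :=
  forall (n : nat) (s : n.-tuple int) (k : int) (B : set (n.-tuple R)),
    measurable B ->
    P [set w | B [tuple X (tnth s i) w | i < n]] =
    P [set w | B [tuple X (tnth s i + k) w | i < n]].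

(* The p-quantile of X, as the generalized inverse of its distribution
   function. *)
Definition quantile P (X : Omega -> R) (p : R) : R :=
  inf [set x : R | (p%:E <= P [set w | (X w <= x)%R])%E].

(* X_T = o_p(rho_T). *)
Definition littleo_in_probability P (X : nat -> Omega -> R) (rho : nat -> R)
    : Prop :=
  forall e : R, 0 < e ->
    P [set w | e < `|X T w / rho T|] @[T --> \oo] --> 0%E.

(* The sum over all integers l of Cov(X_0, X_l), split as the sum over l >= 0
   plus the sum over l < 0. *)
Definition long_run_variance P (X : int -> {RV P >-> R}) : R :=
  limn (series (fun l : nat => fine (covariance P (X 0) (X l%:Z)))) +
  limn (series (fun l : nat => fine (covariance P (X 0) (X (- l.+1%:Z))))).

End Probability.

Section Filters.
Context {R : realType}.

Definition coordinate_cylinders : set (set (int -> R)) :=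
  [set C | exists (k : int) (A : set R),
     measurable A /\ C = [set x : int -> R | A (x k)]].

(* Measurability of G for the product sigma-algebra on R^Z. *)
Definition measurable_filter (G : (int -> R) -> R) : Prop :=
  measurable_fun [set: g_sigma_algebraType coordinate_cylinders]
    (G : g_sigma_algebraType coordinate_cylinders -> R).

Context {d : measure_display} {Omega : measurableType d} {P : probability Omega R}.

(* The argument of G at time t is the shifted sequence k |-> eta_(t+k): the
   innovation eta_t sits at position 0. *)
Definition filtered (G : (int -> R) -> R) (eta : int -> {RV P >-> R})
    (t : int) (w : Omega) : R :=
  G (fun k => eta (t + k) w).

Definition coupled (G : (int -> R) -> R) (eta eta' : int -> {RV P >-> R})
    (t : int) (w : Omega) : R :=
  G (fun k => if t + k == 0 then eta' 0 w else eta (t + k) w).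

Definition dependence_coef (q : R) (G : (int -> R) -> R)
    (eta eta' : int -> {RV P >-> R}) (t : int) : \bar R :=
  ('N[P]_(q%:E) [EFin \o (filtered G eta t \- coupled G eta eta' t)%R])%E.

Definition dependence_tail (q : R) (G : (int -> R) -> R)
    (eta eta' : int -> {RV P >-> R}) (t : nat) : \bar R :=
  \esum_(s in [set s : int | (t <= `|s|)%N]) dependence_coef q G eta eta' s.

End Filters.

Section Multiscale.
Context {R : realType}.
Implicit Types (K f : R -> R) (G : {fset R * R}) (T t : nat) (u h : R).

Definition tau (q : R) : R :=
  (q ^+ 2 - 4 + (q - 2) * Num.sqrt (q ^+ 2 + 20 * q + 4)) / (8 * q).

Definition kernel_condition K : Prop :=
  [/\ forall v, 0 <= K v,
      forall v, K (- v) = K v,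
      (\int[lebesgue_measure]_x (K x)%:E)%E = 1%E,
      closure [set v | K v != 0] = `[-1, 1]%classic &
      exists2 C : R, 0 < C & forall v w, `|K v - K w| <= C * `|v - w|].

(* f is continuously differentiable on [0,1] with derivative f'; at the
   endpoints the derivative is the one-sided one. *)
Definition C1_on_unit f (f' : R -> R) : Prop :=
  (forall x, x \in `[0, 1] ->
     (fun y => (f y - f x) / (y - x)) @ within `[0, 1]%classic x^' --> f' x) /\
  {within `[0, 1]%classic, continuous f'}.

Definition scaled T t u h : R := (t%:R / T%:R - u) / h.

Definition S_ K T (l : nat) u h : R :=
  (T%:R * h)^-1 *
  \sum_(1 <= t < T.+1) K (scaled T t u h) * scaled T t u h ^+ l.

Definition Lambda_ K T t u h : R :=
  K (scaled T t u h) * (S_ K T 0 u h * scaled T t u h - S_ K T 1 u h).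

Definition weight K T t u h : R :=
  Lambda_ K T t u h /
  Num.sqrt (\sum_(1 <= s < T.+1) Lambda_ K T s u h ^+ 2).

Definition lambda_ h : R := Num.sqrt (2 * ln (1 / (2 * h))).

Definition linear_stat K T (y : nat -> R) u h : R :=
  \sum_(1 <= t < T.+1) weight K T t u h * y t.

(* For a nonempty finite set G the supremum is a maximum. *)
Definition multiscale_stat K T G (s : R) (y : nat -> R) : R :=
  sup [set `|linear_stat K T y p.1 p.2 / s| - lambda_ p.2 | p in [set` G]].

End Multiscale.

Section Model.
Context {d : measure_display} {Omega : measurableType d} {R : realType}
  {P : probability Omega R}.

Definition observation (m : nat -> R -> R) (eps : int -> {RV P >-> R})
    (T t : nat) (w : Omega) : R :=
  m T (t%:R / T%:R) + eps t%:Z w.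

Definition estimate (sigma2_hat : forall T : nat, T.-tuple R -> R)
    (m : nat -> R -> R) (eps : int -> {RV P >-> R}) (T : nat) (w : Omega) : R :=
  sigma2_hat T [tuple observation m eps T i.+1 w | i < T].

Definition Psi_hat (K : R -> R) (G : nat -> {fset R * R})
    (sigma2_hat : forall T : nat, T.-tuple R -> R)
    (m : nat -> R -> R) (eps : int -> {RV P >-> R}) (T : nat) (w : Omega) : R :=
  multiscale_stat K T (G T) (Num.sqrt (estimate sigma2_hat m eps T w))
    (fun t => observation m eps T t w).

Definition Phi (K : R -> R) (G : nat -> {fset R * R})
    (Z : nat -> {RV P >-> R}) (T : nat) (w : Omega) : R :=
  multiscale_stat K T (G T) 1 (fun t => Z t w).

End Model.

(* Main.v *)
Require Import Defs.
From HB Require Import structures.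
From mathcomp Require Import all_boot all_order all_algebra finmap.
From mathcomp Require Import all_classical all_reals all_analysis.
From mathcomp Require Import measurable_realfun.
From mathcomp Require Import ring lra zify.

(** Suppose that [m'] is at least [B = c_T * sqrt (log T / (T h^3))] on one window
    [u-h, u+h] of the grid.  The claim follows from comparing the orders of
    magnitude of four quantities at that window, with [L = sqrt (log T)].

    - The signal [sum_t w_t m(t/T)] is at least [kappa * c_T * L]
      ([signal_lower_bound]).  The local linear weights annihilate constants, and,
      up to a positive factor, they are [K_t * (v_t - vs)], where [v_t] is the
      rescaled design point and [vs] the kernel-weighted mean of the [v_t].
      Centring [m] at the design point of [vs] makes all summands nonnegative, so
      only the spread [sum_t K_t (v_t - vs)^2] matters; it is of order [T h] because
      the kernel charges both an interval to the right of zero and its mirror image.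

    - The noise [sum_t w_t eps_t] has a bounded second moment
      ([noise_second_moment]).  This is an inequality of Efron-Stein type.  With
      [F] the noise as a function of the innovations, [E F(eta)^2] is the sum, over
      the innovations [eta_k] replaced one after the other by independent copies, of
      the changes of [E (F(eta) F(.))].  Exchanging [eta_k] with its copy leaves the
      joint law unchanged and shows that each change is at most half the squared
      norm of [F - F^(k)] ([one_swap]); these norms are controlled by the
      dependence coefficients, which are summable.  Replacing the innovations in a
      large window decorrelates the two factors in the limit, because a functional
      of a sequence hardly depends on the innovations far away
      ([replacement_limit]).

    - The Gaussian quantile is at most [C * L] ([quantile_Phi_bound]), by a union
      bound over the polynomially many points of the grid, since every statistic is
      normal with variance at most one.

    - The correction [lambda h] is at most [2 * L], since [T h] tends to infinity.

    As [sigma_hat] stays bounded away from zero and infinity with probability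
    tending to one, the test statistic is then of order [c_T * L] at least, while
    the critical value is of order [L]; and [c_T] tends to infinity. *)

Set Implicit Arguments.
Unset Strict Implicit.
Unset Printing Implicit Defensive.

Import Order.TTheory GRing.Theory Num.Theory.
Import numFieldNormedType.Exports.

Local Open Scope classical_set_scope.
Local Open Scope ring_scope.

(** * Laws of paths *)

Section Expectation.
Context {d d' : measure_display} {T : measurableType d} {Y : measurableType d'}
  {R : realType} (P : probability T R).

Lemma eq_law_integral (f g : T -> Y) (H : Y -> \bar R) :
  measurable_fun setT f -> measurable_fun setT g -> measurable_fun [set: Y] H ->
  (forall A, measurable A -> P (f @^-1` A) = P (g @^-1` A)) ->
  (\int[P]_w H (f w) = \int[P]_w H (g w))%E.
Proof.
move=> mf mg mH fg.
pose F : {mfun T >-> Y} := HB.pack f (isMeasurableFun.Build _ _ _ _ _ mf).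
pose G : {mfun T >-> Y} := HB.pack g (isMeasurableFun.Build _ _ _ _ _ mg).
have pos (h : Y -> \bar R) : measurable_fun [set: Y] h -> (forall y, 0 <= h y)%E ->
    (\int[P]_w h (f w) = \int[P]_w h (g w))%E.
  move=> mh h0.
  transitivity (\int[distribution P F]_y h y)%E.
    by rewrite ge0_integral_distribution.
  rewrite (eq_measure_integral (distribution P G)); last first.
    by move=> A mA _; exact: fg.
  by rewrite ge0_integral_distribution.
rewrite [LHS]integralE [RHS]integralE; congr (_ - _)%E.
  have := pos (funepos H) (measurable_funepos mH) (fun=> funepos_ge0 _ _).
  by rewrite !unlock.
have := pos (funeneg H) (measurable_funeneg mH) (fun=> funeneg_ge0 _ _).
by rewrite !unlock.
Qed.

End Expectation.

Section PathSpace.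
Context {R : realType}.

Definition cylinders (J : Type) : set (set (J -> R)) :=
  [set C | exists (k : J) (A : set R),
     measurable A /\ C = [set x : J -> R | A (x k)]].

Definition rectangles (J : choiceType) : set (set (J -> R)) :=
  [set C | exists (F : {fset J}) (A : J -> set R),
     (forall j, measurable (A j)) /\
     C = [set x : J -> R | forall j, j \in F -> A j (x j)]].

Local Notation path J := (g_sigma_algebraType (@cylinders J)).

Lemma measurable_coordinate (J : Type) (j : J) :
  measurable_fun setT (fun x : path J => x j : R).
Proof.
move=> _ A mA; rewrite setTI; apply: sub_sigma_algebra.
by exists j, A.
Qed.

Lemma measurable_path d (T : measurableType d) (J : Type) (f : T -> path J) :
  (forall j, measurable_fun setT (fun w => f w j : R)) -> measurable_fun setT f.
Proof.
move=> mf; apply: (@measurability _ _ T (path J) setT f (@cylinders J)) => //;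
  move=> _ [_ [j [A [mA ->]]] <-]; exact: mf.
Qed.

Lemma rectangles_setI (J : choiceType) : setI_closed (@rectangles J).
Proof.
move=> _ _ [F [A [mA ->]]] [F' [A' [mA' ->]]].
exists (F `|` F')%fset, (fun j => (if j \in F then A j else setT) `&`
   (if j \in F' then A' j else setT)); split.
  by move=> j; apply: measurableI; case: ifP.
apply/seteqP; split => x /=.
  move=> [h h'] j; rewrite in_fsetU => _; split.
    by case: ifP => // /h.
  by case: ifP => // /h'.
move=> h; split => j jF.
  by have [] := h j; rewrite ?in_fsetU ?jF.
by have [] := h j; rewrite ?in_fsetU ?jF ?orbT.
Qed.

Lemma measurable_rectangle (J : choiceType) (C : set (path J)) :
  @rectangles J C -> measurable C.
Proof.
move=> [F [A [mA ->]]].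
have -> : [set x : J -> R | forall j, j \in F -> A j (x j)] =
   \bigcap_(j in [set` F]) [set x : J -> R | A j (x j)].
  by apply/seteqP; split => x /= h j; exact: h.
apply: (@fin_bigcap_measurable _ (path J)) => // j _.
rewrite -[X in measurable X]setTI.
exact: (@measurable_coordinate J j _ (A j)).
Qed.

Lemma sigma_rectangles (J : choiceType) :
  @measurable _ (path J) = <<s @rectangles J >>.
Proof.
apply/seteqP; split.
  apply: smallest_sub; first exact: smallest_sigma_algebra.
  move=> _ [j [A [mA ->]]]; apply: sub_sigma_algebra.
  exists [fset j]%fset, (fun=> A); split => //.
  apply/seteqP; split => x /=; first by move=> ? k; rewrite inE => /eqP ->.
  by apply; rewrite inE.
apply: smallest_sub; first exact: sigma_algebra_measurable.
exact: measurable_rectangle.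
Qed.

(** Rectangles form a generating pi-system, so a law on a path space is determined
    on them.  The event [E] allows the same lemma to give equality of laws
    ([E = setT]) and independence of [E] from a path. *)
Lemma path_law_unique d (T : measurableType d) (P : probability T R)
    (J : choiceType) (f g : T -> path J) (E : set T) :
  measurable_fun setT f -> measurable_fun setT g -> measurable E ->
  (forall C, @rectangles J C ->
     P (E `&` f @^-1` C) = P E * P (g @^-1` C))%E ->
  forall C, measurable C -> (P (E `&` f @^-1` C) = P E * P (g @^-1` C))%E.
Proof.
move=> mf mg mE H C mC.
pose F : {mfun T >-> path J} := HB.pack f (isMeasurableFun.Build _ _ _ _ _ mf).
pose G : {mfun T >-> path J} := HB.pack g (isMeasurableFun.Build _ _ _ _ _ mg).
have c0 : 0 <= fine (P E) by rewrite fine_ge0.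
pose m1 : {measure set (path J) -> \bar R} := pushforward (mrestr P mE) F.
pose m2 : {measure set (path J) -> \bar R} := mscale (NngNum c0) (distribution P G).
have cE : (fine (P E))%:E = P E by rewrite fineK // fin_num_measure.
suff : m1 mf C = m2 C.
  by rewrite /m1 /m2 /= /pushforward /mrestr /mscale /= cE setIC.
apply: (@measure_unique _ R (path J) (@rectangles J) (fun=> setT)
  _ _ _ _ (m1 mf) m2 _ _ C mC) => //.
- exact: sigma_rectangles.
- exact: rectangles_setI.
- move=> _; exists fset0, (fun=> setT); split => //.
  by apply/seteqP; split.
- by apply/seteqP; split => // x _; exists 0%N.
- move=> A rA; rewrite /m1 /m2 /= /pushforward /mrestr /mscale /= cE setIC.
  exact: H.
- move=> _; rewrite /= /pushforward /mrestr /= preimage_setT setTI.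
  by rewrite -ge0_fin_numE // fin_num_measure.
Qed.

End PathSpace.

(** * Independence of disjoint families *)

(** The joint law of an independent pair is the product of the marginals, so this
    is Tonelli on the plane.  The integrand is truncated below at zero only to be
    nonnegative on the whole plane. *)
Lemma indep_integralM d (T : measurableType d) (R : realType)
    (P : probability T R) (U V : T -> R) :
  measurable_fun setT U -> measurable_fun setT V ->
  (forall w, 0 <= U w) -> (forall w, 0 <= V w) ->
  (forall A B, measurable A -> measurable B ->
     P (U @^-1` A `&` V @^-1` B) = P (U @^-1` A) * P (V @^-1` B))%E ->
  (\int[P]_w (U w * V w)%:E = \int[P]_w (U w)%:E * \int[P]_w (V w)%:E)%E.
Proof.
move=> mU mV U0 V0 ind.
pose XU : {RV P >-> R} := HB.pack U (isMeasurableFun.Build _ _ _ _ _ mU).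
pose XV : {RV P >-> R} := HB.pack V (isMeasurableFun.Build _ _ _ _ _ mV).
have mW : measurable_fun setT (fun w => (U w, V w)) by exact: measurable_fun_pair.
pose W : {mfun T >-> (R * R)%type} :=
  HB.pack (fun w => (U w, V w)) (isMeasurableFun.Build _ _ _ _ _ mW).
pose f (z : R * R) : \bar R := (Num.max z.1 0 * Num.max z.2 0)%:E.
have mf : measurable_fun [set: R * R] f.
  apply/measurable_EFinP; apply: measurable_funM; apply: measurable_maxr => //.
have f0 z : (0 <= f z)%E by rewrite lee_fin mulr_ge0 // le_max lexx orbT.
pose g (x : R) : \bar R := (Num.max x 0)%:E.
have mg : measurable_fun [set: R] g.
  by apply/measurable_EFinP; apply: measurable_maxr.
have g0 z : (0 <= g z)%E by rewrite lee_fin le_max lexx orbT.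
transitivity (\int[distribution P W]_z f z)%E.
  rewrite ge0_integral_distribution //; apply: eq_integral => w _.
  by rewrite /f /= !max_l.
transitivity (\int[(distribution P XU \x distribution P XV)%E]_z f z)%E.
  apply: eq_measure_integral => A mA _; apply/esym.
  apply: (@product_measure_unique _ _ _ _ _ (distribution P XU)
    (distribution P XV) (distribution P W)) => //.
rewrite fubini_tonelli1 //.
transitivity (\int[distribution P XU]_x (g x * \int[P]_w (V w)%:E))%E.
  apply: eq_integral => x _; rewrite /fubini_F /f.
  transitivity (\int[distribution P XV]_y ((Num.max x 0)%:E * g y))%E => //.
  rewrite ge0_integralZl_EFin //; last by rewrite le_max lexx orbT.
  congr (_ * _)%E; rewrite (ge0_integral_distribution XV mg g0).
  by apply: eq_integral => w _; rewrite /g /= max_l.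
rewrite ge0_integralZr //; last by apply: integral_ge0 => w _; rewrite lee_fin.
congr (_ * _)%E; rewrite (ge0_integral_distribution XU mg g0).
by apply: eq_integral => w _; rewrite /g /= max_l.
Qed.

Section Independence.
Context {d : measure_display} {T : measurableType d} {R : realType}
  {P : probability T R} {I : choiceType}.
Variable X : I -> {RV P >-> R}.

Local Notation path J := (g_sigma_algebraType (@cylinders R J)).

Definition subpath (J : Type) (p : J -> I) (w : T) : path J :=
  fun j => X (p j) w.

Lemma measurable_subpath (J : Type) (p : J -> I) : measurable_fun setT (subpath p).
Proof. by apply: measurable_path => j; exact: measurable_funPT. Qed.

(** Independence speaks of sets indexed by [I], rectangles of sets indexed by [J].
    The index set [F] must not depend on the injection, so that probabilities along
    two injections can be compared factor by factor. *)
Lemma rectangle_subpath (J : choiceType) (p : J -> I) (C : set (J -> R)) :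
  injective p -> rectangles C ->
  exists (F : {fset J}) (A : I -> set R), [/\ forall i, measurable (A i),
    subpath p @^-1` C = \bigcap_(i in [set` [fset p j | j in F]%fset]) (X i @^-1` A i) &
    forall p' : J -> I, injective p' -> exists A' : I -> set R,
      [/\ forall i, measurable (A' i), forall j, A' (p' j) = A (p j) &
       subpath p' @^-1` C =
         \bigcap_(i in [set` [fset p' j | j in F]%fset]) (X i @^-1` A' i)]].
Proof.
move=> pinj [F [B [mB ->]]].
(* the rectangle transported along an injection; coordinates outside its range are free *)
pose ext (p' : J -> I) i :=
  if pselect (exists j, p' j = i) is left h then B (projT1 (cid h)) else setT.
have mext p' i : measurable (ext p' i) by rewrite /ext; case: pselect.
have extE p' : injective p' -> forall j, ext p' (p' j) = B j.
  move=> p'inj j; rewrite /ext; case: pselect; last by case; exists j.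
  by move=> h; case: cid => k /= /p'inj ->.
have eqE p' : injective p' ->
    subpath p' @^-1` [set x : J -> R | forall j, j \in F -> B j (x j)] =
     \bigcap_(i in [set` [fset p' j | j in F]%fset]) (X i @^-1` ext p' i).
  move=> p'inj; apply/seteqP; split=> w /=.
    by move=> h i /= /imfsetP[/= j jF ->]; rewrite /preimage /= extE //; exact: h.
  move=> h j jF; have := h (p' j); rewrite /preimage /= extE //; apply.
  by apply/imfsetP; exists j.
exists F, (ext p); split => //; first exact: eqE.
move=> p' p'inj; exists (ext p'); split => //; last exact: eqE.
by move=> j; rewrite !extE.
Qed.

(** All symmetries used below (shifts, swaps of an innovation with its copy) are
    instances of this invariance. *)
Lemma iid_subpath_law (J : choiceType) (p p' : J -> I) : iid X ->
  injective p -> injective p' ->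
  forall C : set (path J), measurable C ->
  P (subpath p @^-1` C) = P (subpath p' @^-1` C).
Proof.
move=> [ind idd] pinj p'inj C mC.
have := @path_law_unique _ _ _ P J (subpath p) (subpath p') setT
  (measurable_subpath p) (measurable_subpath p') measurableT _ C mC.
rewrite setTI probability_setT mul1e; apply => {mC}C rC.
rewrite setTI mul1e.
have [F [A [mA -> /(_ p' p'inj)[A' [mA' AA' ->]]]]] := rectangle_subpath pinj rC.
rewrite !ind // !big_imfset /=; first last.
- by move=> j k _ _; exact: pinj.
- by move=> j k _ _; exact: p'inj.
apply: eq_bigr => j _; rewrite AA'; exact: idd.
Qed.

Lemma indep_subpath (J J' : choiceType) (p : J -> I) (p' : J' -> I) :
  mutually_independent X ->
  injective p -> injective p' -> (forall j j', p j <> p' j') ->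
  forall (C : set (path J)) (C' : set (path J')), measurable C -> measurable C' ->
  (P (subpath p @^-1` C `&` subpath p' @^-1` C') =
   P (subpath p @^-1` C) * P (subpath p' @^-1` C'))%E.
Proof.
move=> ind pinj p'inj pp' C C' mC mC'.
have mpre (K : Type) (r : K -> I) (B : set (path K)) : measurable B ->
    measurable (subpath r @^-1` B).
  by move=> mB; rewrite -[X in measurable X]setTI; exact: measurable_subpath.
apply: (path_law_unique (measurable_subpath p') (measurable_subpath p')) => //.
  exact: mpre.
move=> {mC'}C' rC'; rewrite setIC [RHS]muleC.
apply: (path_law_unique (measurable_subpath p) (measurable_subpath p)) => //.
  by apply: mpre; exact: measurable_rectangle.
move=> {mC}C rC.
have [F [A [mA AE _]]] := rectangle_subpath pinj rC.
have [F' [A' [mA' AE' _]]] := rectangle_subpath p'inj rC'.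
pose G := [fset p j | j in F]%fset; pose G' := [fset p' j | j in F']%fset.
(* both events are written over the same index set, where each factor has one trivial side *)
pose B i := if i \in G then A i else setT.
pose B' i := if i \in G' then A' i else setT.
have mB i : measurable (B i) by rewrite /B; case: ifP.
have mB' i : measurable (B' i) by rewrite /B'; case: ifP.
have BE : subpath p @^-1` C = \bigcap_(i in [set` (G `|` G')%fset]) (X i @^-1` B i).
  rewrite AE; apply/seteqP; split=> w h i /=.
    by rewrite /preimage /B /=; case: ifPn => // iG _; exact: h.
  by move=> iG; have := h i; rewrite /preimage /B /= in_fsetU iG /=; apply.
have BE' : subpath p' @^-1` C' = \bigcap_(i in [set` (G `|` G')%fset]) (X i @^-1` B' i).
  rewrite AE'; apply/seteqP; split=> w h i /=.
    by rewrite /preimage /B' /=; case: ifPn => // iG _; exact: h.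
  by move=> iG; have := h i; rewrite /preimage /B' /= in_fsetU iG orbT; apply.
rewrite BE BE' -bigcapI.
under eq_bigcapr do rewrite -preimage_setI.
rewrite !ind // -?big_split /=; last by move=> *; exact: measurableI.
apply: eq_bigr => i _; rewrite /B /B'.
case: (boolP (i \in G')) => [/imfsetP[/= j' _ ->]|_]; last first.
  by rewrite setTI preimage_setT probability_setT mul1e.
case: ifPn => [/imfsetP[/= j _ /esym/pp']//|_].
by rewrite setIT preimage_setT probability_setT mule1.
Qed.

End Independence.

(** * Moments on a probability space *)

Section Moments.
Context {d : measure_display} {T : measurableType d} {R : realType}
  (P : probability T R).
Implicit Types f g : T -> R.

Definition L1 f := P.-integrable setT (fun w => (f w)%:E).
Definition Ex f : R := \int[P]_w f w.
Definition moment k f :=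
  measurable_fun setT f /\ L1 (fun w => f w ^+ k).

Lemma measurable_abs_gt f (x : R) : measurable_fun setT f ->
  measurable [set w | x < `|f w|].
Proof.
move=> mf; have := measurableT_comp (@normr_measurable R setT) mf.
move=> /(_ measurableT `]x, +oo[%classic (measurable_itv _)).
by rewrite setTI; congr (measurable _); apply/seteqP; split => w /=;
  rewrite in_itv /= andbT.
Qed.

Lemma L1_le f g : measurable_fun setT f -> L1 g -> (forall w, `|f w| <= g w) -> L1 f.
Proof.
move=> mf ig fg; apply: (@le_integrable _ _ _ P _ measurableT _ (EFin \o g)) => //.
  exact/measurable_EFinP.
by move=> w _ /=; rewrite lee_fin (le_trans (fg w)) // ler_norm.
Qed.

Lemma L1D f g : L1 f -> L1 g -> L1 (fun w => f w + g w).
Proof. by move=> hf hg; apply: (integrableD _ hf hg). Qed.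

Lemma L1B f g : L1 f -> L1 g -> L1 (fun w => f w - g w).
Proof. by move=> hf hg; apply: (integrableB _ hf hg). Qed.

Lemma L1Z c f : L1 f -> L1 (fun w => c * f w).
Proof. by move=> hf; apply: (integrableZl _ c hf). Qed.

Lemma L1_cst c : L1 (fun=> c).
Proof. exact: finite_measure_integrable_cst. Qed.

Lemma L1_indic A : measurable A -> L1 (\1_A).
Proof. by move=> mA; exact: (@integrable_indic _ _ _ P). Qed.

Lemma ExD f g : L1 f -> L1 g -> Ex (fun w => f w + g w) = Ex f + Ex g.
Proof. by move=> *; exact: RintegralD. Qed.

Lemma ExB f g : L1 f -> L1 g -> Ex (fun w => f w - g w) = Ex f - Ex g.
Proof. by move=> *; exact: RintegralB. Qed.

Lemma ExZ c f : L1 f -> Ex (fun w => c * f w) = c * Ex f.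
Proof. by move=> *; exact: RintegralZl. Qed.

Lemma Ex_cst c : Ex (fun=> c) = c.
Proof.
rewrite /Ex Rintegral_cst // -[RHS]mulr1; congr (_ * _).
exact: (congr1 fine (probability_setT P)).
Qed.

Lemma Ex_ge0 f : (forall w, 0 <= f w) -> 0 <= Ex f.
Proof. by move=> f0; apply: Rintegral_ge0. Qed.

Lemma Ex_le f g : L1 f -> L1 g -> (forall w, f w <= g w) -> Ex f <= Ex g.
Proof. by move=> *; apply: le_Rintegral. Qed.

Lemma Ex_EFin f : L1 f -> ((Ex f)%:E = \int[P]_w (f w)%:E)%E.
Proof. by move=> f1; rewrite /Ex /Rintegral fineK //; exact: integrable_fin_num. Qed.

Lemma Ex_indic A : measurable A -> (Ex (\1_A))%:E = P A.
Proof. by move=> mA; rewrite Ex_EFin ?integral_indic ?setIT //; exact: L1_indic. Qed.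

Lemma mom2M f g : moment 2 f -> moment 2 g -> L1 (fun w => f w * g w).
Proof.
move=> [mf f2] [mg g2].
apply: (L1_le _ (L1D f2 g2)); first exact: measurable_funM.
move=> w; rewrite normrM -[f w ^+ 2]real_normK ?num_real //.
rewrite -[g w ^+ 2]real_normK ?num_real //.
have := sqr_ge0 (`|f w| - `|g w|); have := normr_ge0 (f w).
have := normr_ge0 (g w); nra.
Qed.

Lemma mom2_cst c : moment 2 (fun=> c).
Proof. by split => //; exact: L1_cst. Qed.

Lemma momZ k c f : moment k f -> moment k (fun w => c * f w).
Proof.
move=> [mf fk]; split; first exact: measurable_funM.
by under eq_fun do rewrite exprMn; exact: L1Z.
Qed.

Lemma mom2B f g : moment 2 f -> moment 2 g -> moment 2 (fun w => f w - g w).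
Proof.
move=> f2 g2; have [[mf fi] [mg gi]] := (f2, g2).
split; first exact: measurable_funB.
have -> : (fun w => (f w - g w) ^+ 2) =
    (fun w => (f w ^+ 2 - 2 * (f w * g w)) + g w ^+ 2).
  by apply/funext => w; ring.
by apply: L1D => //; apply: L1B => //; apply: L1Z; exact: mom2M.
Qed.

Lemma mom4B f g : moment 4 f -> moment 4 g -> moment 4 (fun w => f w - g w).
Proof.
move=> [mf fi] [mg gi]; split; first exact: measurable_funB.
apply: (L1_le _ (L1Z 8 (L1D fi gi))).
  by apply: measurable_funX; exact: measurable_funB.
move=> w; rewrite ger0_norm ?exprn_even_ge0 //.
have := sqr_ge0 (f w ^+ 2 - g w ^+ 2); have := sqr_ge0 (f w + g w).
nra.
Qed.

Lemma mom42 f : moment 4 f -> moment 2 f.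
Proof.
move=> [mf fi]; split => //; apply: (L1_le _ (L1D fi (L1_cst 1))).
  exact: measurable_funX.
move=> w; rewrite ger0_norm ?sqr_ge0 //.
have := sqr_ge0 (f w ^+ 2 - 1); nra.
Qed.

(** The discriminant argument: [E (s f - t g)^2] is nonnegative for all [s] and
    [t]. *)
Lemma cauchy_schwarz f g : moment 2 f -> moment 2 g ->
  `|Ex (fun w => f w * g w)| <=
  Num.sqrt (Ex (fun w => f w ^+ 2)) * Num.sqrt (Ex (fun w => g w ^+ 2)).
Proof.
move=> f2 g2; have [[mf fi] [mg gi]] := (f2, g2).
have fg := mom2M f2 g2.
set a := Ex (fun w => f w ^+ 2); set b := Ex (fun w => g w ^+ 2).
set c := Ex _.
have a0 : 0 <= a by apply: Ex_ge0 => w; exact: sqr_ge0.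
have b0 : 0 <= b by apply: Ex_ge0 => w; exact: sqr_ge0.
have Q s t : 0 <= s ^+ 2 * a - 2 * s * t * c + t ^+ 2 * b.
  have -> : s ^+ 2 * a - 2 * s * t * c + t ^+ 2 * b =
      Ex (fun w => (s * f w - t * g w) ^+ 2).
    under [in RHS]eq_fun => w.
      rewrite (_ : _ ^+ 2 = (s ^+ 2 * f w ^+ 2 - (2 * s * t) * (f w * g w)) +
        t ^+ 2 * g w ^+ 2); last by ring.
      over.
    rewrite ExD ?ExB ?ExZ //; try exact: L1Z.
    by apply: L1B; exact: L1Z.
  by apply: Ex_ge0 => w; exact: sqr_ge0.
suff H : c ^+ 2 <= a * b.
  rewrite -sqrtrM // -[leLHS]ger0_norm // -sqrtr_sqr ler_wsqrtr //.
  by rewrite -normrX ger0_norm // sqr_ge0.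
have [b1|] := ltP 0 b.
  have := Q b c; have : 0 < b by []. nra.
rewrite le_eqVlt ltNge b0 orbF => /eqP b1.
have [->|c1] := eqVneq c 0; first by rewrite expr0n /= b1 mulr0.
(* if [b = 0], the quadratic form is affine in [t] and takes the value -1 here *)
have := Q 1 ((a + 1) / (2 * c)); rewrite b1.
have -> : 1 ^+ 2 * a - 2 * 1 * ((a + 1) / (2 * c)) * c + ((a + 1) / (2 * c)) ^+ 2 * 0 = -1.
  by field.
by rewrite lerNr oppr0 ler10.
Qed.

(** Chebyshev, stated without centring. *)
Lemma markov_sq f x : 0 < x -> moment 2 f ->
  (P [set w | (x < `|f w|)%R] <= (Ex (fun w => f w ^+ 2) / x ^+ 2)%:E)%E.
Proof.
move=> x0 [mf fi].
have mA := measurable_abs_gt x mf.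
rewrite -Ex_indic // lee_fin ler_pdivlMr ?exprn_gt0 // mulrC -ExZ; last exact: L1_indic.
apply: Ex_le => //; first by apply: L1Z; exact: L1_indic.
move=> w; rewrite indicE; case: (boolP (w \in _)); last by rewrite mulr0 sqr_ge0.
by rewrite inE /= mulr1 -[f w ^+ 2]real_normK ?num_real // ler_sqr ?nnegrE ?(ltW x0) // => /ltW.
Qed.

(** The positive and negative parts of [f] and [g] are independent and
    nonnegative, so the expectation of the product splits. *)
Lemma indep_Ex0 f g : moment 2 f -> moment 2 g -> Ex g = 0 ->
  (forall A B, measurable A -> measurable B ->
     P (f @^-1` A `&` g @^-1` B) = P (f @^-1` A) * P (g @^-1` B))%E ->
  Ex (fun w => f w * g w) = 0.
Proof.
move=> f2 g2 g0 ind.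
have [[mf _] [mg _]] := (f2, g2).
pose pos (x : R) := Num.max x 0; pose neg (x : R) := Num.max (- x) 0.
have mpos : measurable_fun setT pos by apply: measurable_maxr.
have mneg : measurable_fun setT neg.
  by apply: measurable_maxr => //; exact: measurableT_comp.
have pE x : x = pos x - neg x.
  rewrite /pos /neg; have [x0|x0] := leP 0 x.
    by rewrite (@max_r _ _ (- x)) ?oppr_le0 // subr0.
  by rewrite (@max_l _ _ (- x)) ?oppr_ge0 ?(ltW x0) // sub0r opprK.
have pos0 x : 0 <= pos x by rewrite le_max lexx orbT.
have neg0 x : 0 <= neg x by rewrite le_max lexx orbT.
have mom_part (p : R -> R) h : measurable_fun setT p -> (forall x, `|p x| <= `|x|) ->
    moment 2 h -> moment 2 (fun w => p (h w)).
  move=> mp ph [mh hi]; split; first exact: measurableT_comp.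
  apply: (L1_le _ hi); first by apply: measurable_funX; exact: measurableT_comp.
  move=> w; rewrite normrX -[h w ^+ 2]real_normK ?num_real //.
  by rewrite ler_sqr ?nnegrE.
have posn x : `|pos x| <= `|x|.
  rewrite /pos; have [x0|x0] := leP 0 x; by rewrite ?normr0.
have negn x : `|neg x| <= `|x|.
  rewrite /neg; have [x0|x0] := leP 0 x; first by rewrite max_r ?oppr_le0 // normr0.
  by rewrite max_l ?normrN // oppr_ge0 ltW.
have fact (p r : R -> R) : measurable_fun setT p -> measurable_fun setT r ->
    (forall x, 0 <= p x) -> (forall x, 0 <= r x) ->
    (forall x, `|p x| <= `|x|) -> (forall x, `|r x| <= `|x|) ->
    Ex (fun w => p (f w) * r (g w)) = Ex (fun w => p (f w)) * Ex (fun w => r (g w)).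
  move=> mp mr p0 r0 pn rn; rewrite /Ex /Rintegral indep_integralM //.
  - rewrite fineM //; apply: integrable_fin_num => //.
      have := mom2M (mom_part p f mp pn f2) (mom2_cst 1).
      by under eq_fun do rewrite mulr1.
    have := mom2M (mom_part r g mr rn g2) (mom2_cst 1).
    by under eq_fun do rewrite mulr1.
  - exact: measurableT_comp.
  - exact: measurableT_comp.
  - move=> A B mA mB; apply: (ind (p @^-1` A) (r @^-1` B)).
      by rewrite -[X in measurable X]setTI; exact: mp.
    by rewrite -[X in measurable X]setTI; exact: mr.
have L1part (p : R -> R) h : measurable_fun setT p -> (forall x, `|p x| <= `|x|) ->
    moment 2 h -> L1 (fun w => p (h w)).
  move=> mp pn h2; have := mom2M (mom_part p h mp pn h2) (mom2_cst 1).
  by under eq_fun do rewrite mulr1.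
have key (p : R -> R) : measurable_fun setT p -> (forall x, 0 <= p x) ->
    (forall x, `|p x| <= `|x|) -> Ex (fun w => p (f w) * g w) = 0.
  move=> mp p0 pn.
  under eq_fun => w do rewrite [g w]pE mulrBr.
  rewrite ExB; last 2 first.
  - by apply: mom2M; exact: mom_part.
  - by apply: mom2M; exact: mom_part.
  rewrite !fact // -mulrBr -ExB; try exact: L1part.
  have -> : (fun w => pos (g w) - neg (g w)) = g by apply/funext => w; rewrite -pE.
  by rewrite g0 mulr0.
under eq_fun => w do rewrite [f w]pE mulrBl.
rewrite ExB ?key ?subrr //; by apply: mom2M => //; exact: mom_part.
Qed.

(** Bounded fourth moments give the uniform integrability needed to upgrade
    convergence in probability: pointwise,
    [x^2 <= a^2 + b2 * 1_(|x| > a) + x^4 / b2] for all [a] and [b2 > 0]. *)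
Lemma prob_to_L2 (D : nat -> T -> R) (M : R) :
  (forall n, moment 4 (D n)) -> (forall n, Ex (fun w => D n w ^+ 4) <= M) ->
  (forall e, 0 < e -> \forall n \near \oo, (P [set w | (e < `|D n w|)%R] <= e%:E)%E) ->
  forall e, 0 < e -> \forall n \near \oo, Ex (fun w => D n w ^+ 2) <= e.
Proof.
move=> D4 DM DP e e0.
have M0 : 0 <= M.
  by apply: le_trans (DM 0%N); apply: Ex_ge0 => w; rewrite exprn_even_ge0.
pose b2 := 3 * (M + 1) / e.
have b20 : 0 < b2 by rewrite divr_gt0 // mulr_gt0 // ltr_wpDl.
pose a := Num.min 1 (Num.min (e / 3) (e / 3 / b2)).
have e30 : 0 < e / 3 by rewrite divr_gt0.
have a0 : 0 < a by rewrite !lt_min ltr01 e30 divr_gt0.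
have [a1 a2 a3] : [/\ a <= 1, a <= e / 3 & a <= e / 3 / b2].
  by split; rewrite /a !ge_min lexx ?orbT.
near=> n.
have PA0 : (P [set w | (a < `|D n w|)%R] <= a%:E)%E by near: n; exact: DP.
have [mD iD] := D4 n; have [_ iD2] := mom42 (D4 n).
have mA := measurable_abs_gt a mD.
set A := [set w | a < `|D n w|] in mA PA0.
have PA : Ex (\1_A) <= a.
  by rewrite -lee_fin Ex_indic.
have : Ex (fun w => D n w ^+ 2) <=
    Ex (fun w => (a ^+ 2 + b2 * \1_A w) + b2^-1 * D n w ^+ 4).
  apply: Ex_le => //.
    by apply: L1D; [apply: L1D; [exact: L1_cst|exact/L1Z/L1_indic]|exact: L1Z].
  move=> w; set x := D n w.
  have x4 : 0 <= b2^-1 * x ^+ 4 by rewrite mulr_ge0 ?invr_ge0 ?(ltW b20) // exprn_even_ge0.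
  rewrite indicE; case: (boolP (w \in A)) => wA; last first.
    rewrite mulr0 addr0 -[leLHS]addr0 lerD //.
    move: wA; rewrite notin_setE /A /= => /negP; rewrite -leNgt => xa.
    by rewrite -[x ^+ 2]real_normK ?num_real // ler_sqr ?nnegrE // (ltW a0).
  rewrite mulr1; have h0 := sqr_ge0 a.
  have [xb|xb] := leP (x ^+ 2) b2; first by rewrite -[leLHS]addr0 lerD // ler_wpDl.
  rewrite ler_wpDl ?addr_ge0 ?(ltW b20) // -ler_pdivrMl ?invr_gt0 // invrK.
  by rewrite (exprD _ 2 2) ler_wpM2r ?sqr_ge0 // ltW.
rewrite ExD; last 2 first.
- by apply: L1D; [exact: L1_cst|exact/L1Z/L1_indic].
- exact: L1Z.
rewrite ExD; [|exact: L1_cst|exact/L1Z/L1_indic].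
rewrite Ex_cst !ExZ //; last exact: L1_indic.
move=> /le_trans; apply.
have h1 : a ^+ 2 <= e / 3 by rewrite (le_trans _ a2) // expr2 ger_pMl.
have h2 : b2 * Ex (\1_A) <= e / 3.
  by rewrite mulrC -ler_pdivlMr // (le_trans PA).
have h3 : b2^-1 * Ex (fun w => D n w ^+ 4) <= e / 3.
  rewrite ler_pdivrMl // /b2 (_ : _ * (e / 3) = M + 1); last by field; rewrite gt_eqF.
  by rewrite (le_trans (DM n)) // lerDl.
have -> : e = e / 3 + e / 3 + e / 3 by field.
by rewrite !lerD.
Unshelve. all: by end_near. Qed.

End Moments.

(** * Replacing innovations by independent copies *)

Section Coupling.
Context {d : measure_display} {T : measurableType d} {R : realType}
  {P : probability T R}.

Local Notation path J := (g_sigma_algebraType (@cylinders R J)).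

Section Law.
Context {I : choiceType} (X : I -> {RV P >-> R}) (iidX : iid X).

Lemma Ex_law (J : choiceType) (p q : J -> I) (H : path J -> R) :
  measurable_fun setT H -> injective p -> injective q ->
  Ex P (fun w => H (subpath X p w)) = Ex P (fun w => H (subpath X q w)).
Proof.
move=> mH pi qi; rewrite /Ex /Rintegral; congr fine.
apply: (@eq_law_integral _ _ _ _ _ P (subpath X p) (subpath X q) (EFin \o H)).
- exact: measurable_subpath.
- exact: measurable_subpath.
- exact/measurable_EFinP.
- exact: iid_subpath_law.
Qed.

Lemma L1_law (J : choiceType) (p q : J -> I) (H : path J -> R) :
  measurable_fun setT H -> injective p -> injective q ->
  L1 P (fun w => H (subpath X p w)) -> L1 P (fun w => H (subpath X q w)).
Proof.
move=> mH pi qi /integrableP[_ Hp]; apply/integrableP; split.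
  by apply/measurable_EFinP; apply: measurableT_comp => //; exact: measurable_subpath.
apply: le_lt_trans Hp; rewrite le_eqVlt; apply/orP; left; apply/eqP.
apply: (@eq_law_integral _ _ _ _ _ P (subpath X q) (subpath X p)
  (fun x => `|(H x)%:E|%E)).
- exact: measurable_subpath.
- exact: measurable_subpath.
- by apply: measurableT_comp => //; exact/measurable_EFinP.
- exact: iid_subpath_law.
Qed.

Lemma mom_law (J : choiceType) (k : nat) (p q : J -> I) (H : path J -> R) :
  measurable_fun setT H -> injective p -> injective q ->
  moment P k (fun w => H (subpath X p w)) -> moment P k (fun w => H (subpath X q w)).
Proof.
move=> mH pi qi [_ ik]; split.
  by apply: measurableT_comp => //; exact: measurable_subpath.
apply: (@L1_law J p q (fun x => H x ^+ k)) => //.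
exact: measurable_funX.
Qed.

End Law.

Lemma measurable_reindex (J K : Type) (a : K -> J) :
  measurable_fun [set: path J] (fun x : path J => (fun k => x (a k)) : path K).
Proof. by apply: measurable_path => k; exact: measurable_coordinate. Qed.

Lemma measurable_comp_reindex (J K : Type) (a : K -> J) (F : path K -> R) :
  measurable_fun setT F ->
  measurable_fun [set: path J] (fun x : path J => F (fun k => x (a k))).
Proof. by move=> mF; exact: measurableT_comp mF (measurable_reindex a). Qed.

(** The left summand of [int + int] indexes the innovations, the right one their
    copies; the innovations with index in [s] are replaced. *)
Definition replace_at (s : seq int) (k : int) : int + int :=
  if k \in s then inr k else inl k.

Lemma replace_at_inj s : injective (replace_at s).
Proof.
by move=> j k; rewrite /replace_at; case: ifP => _; case: ifP => _ // -[->].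
Qed.

Definition swap_at (s : seq int) (i : int + int) : int + int :=
  match i with
  | inl k => if k \in s then inr k else inl k
  | inr k => if k \in s then inl k else inr k
  end.

Lemma swap_atK s : involutive (swap_at s).
Proof. by case=> k /=; case: ifPn => /= h; rewrite ?h ?(negbTE h). Qed.

Lemma swap_at_inj s : injective (swap_at s).
Proof. exact: inv_inj (swap_atK s). Qed.

Section EfronStein.
Variables (X : int + int -> {RV P >-> R}) (iidX : iid X).
Implicit Types F G : path int -> R.

Definition along F (a : int -> int + int) (w : T) : R := F (subpath X a w).

(** The physical dependence measure of [F] at the innovation [k], in L2. *)
Definition influence F (k : int) : R :=
  Num.sqrt (Ex P (fun w => (along F (replace_at [::]) w - along F (replace_at [:: k]) w) ^+ 2)).

(** Exchanging innovations with their copies leaves the joint law unchanged. *)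
Lemma along_swap s F G a b c :
  measurable_fun setT F -> measurable_fun setT G ->
  Ex P (fun w => along F a w * (along G b w - along G c w)) =
  Ex P (fun w => along F (swap_at s \o a) w *
     (along G (swap_at s \o b) w - along G (swap_at s \o c) w)).
Proof.
move=> mF mG.
pose H (x : path (int + int)%type) : R :=
  F (fun k => x (a k)) * (G (fun k => x (b k)) - G (fun k => x (c k))).
have mH : measurable_fun setT H.
  apply: measurable_funM.
    exact: measurable_comp_reindex.
  by apply: measurable_funB; exact: measurable_comp_reindex.
exact: (Ex_law iidX mH (@inj_id _) (@swap_at_inj s)).
Qed.

Lemma along_swap_sq s G b c : measurable_fun setT G ->
  Ex P (fun w => (along G b w - along G c w) ^+ 2) =
  Ex P (fun w => (along G (swap_at s \o b) w - along G (swap_at s \o c) w) ^+ 2).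
Proof.
move=> mG.
pose H (x : path (int + int)%type) : R :=
  (G (fun k => x (b k)) - G (fun k => x (c k))) ^+ 2.
have mH : measurable_fun setT H.
  apply: measurable_funX.
  by apply: measurable_funB; exact: measurable_comp_reindex.
exact: (Ex_law iidX mH (@inj_id _) (@swap_at_inj s)).
Qed.

Lemma mom_along n F a b : measurable_fun setT F -> injective a -> injective b ->
  moment P n (along F a) -> moment P n (along F b).
Proof. by move=> mF ai bi; exact: mom_law. Qed.

(** Exchanging [eta_k] with its copy turns the second factor into its opposite, so
    the expectation is half of that of the product of two differences.  In the
    second difference the replacements at [s] can be undone by another exchange. *)
Lemma one_swap F G s k :
  measurable_fun setT F -> measurable_fun setT G ->
  moment P 2 (along F (replace_at [::])) -> moment P 2 (along G (replace_at [::])) -> k \notin s ->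
  `|Ex P (fun w => along F (replace_at [::]) w * (along G (replace_at s) w - along G (replace_at (k :: s)) w))|
  <= influence F k * influence G k / 2.
Proof.
move=> mF mG F2 G2 ks.
have F2' a : injective a -> moment P 2 (along F a).
  by move=> ai; exact: (mom_along mF (@replace_at_inj [::]) ai F2).
have G2' a : injective a -> moment P 2 (along G a).
  by move=> ai; exact: (mom_along mG (@replace_at_inj [::]) ai G2).
set V := Ex P _.
have s0 : swap_at [:: k] \o replace_at [::] = replace_at [:: k].
  by apply/funext => j; rewrite /replace_at /=.
have s1 : swap_at [:: k] \o replace_at s = replace_at (k :: s).
  apply/funext => j; rewrite /replace_at /= inE.
  case: (boolP (j \in s)) => /= js; rewrite inE ?orbT ?orbF //.
  by case: eqP => // jk; move: js ks; rewrite jk => ->.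
have s2 : swap_at [:: k] \o replace_at (k :: s) = replace_at s.
  by rewrite -s1; apply/funext => j /=; rewrite swap_atK.
have VN : V = - Ex P (fun w => along F (replace_at [:: k]) w *
    (along G (replace_at s) w - along G (replace_at (k :: s)) w)).
  rewrite /V (along_swap [:: k]) // s0 s1 s2.
  rewrite -[RHS]mulN1r -ExZ.
    by congr Ex; apply/funext => w; ring.
  by apply: mom2M; [|apply: mom2B]; auto using replace_at_inj.
have V2 : V = Ex P (fun w => (along F (replace_at [::]) w - along F (replace_at [:: k]) w) *
    (along G (replace_at s) w - along G (replace_at (k :: s)) w)) / 2.
  have -> : (fun w => (along F (replace_at [::]) w - along F (replace_at [:: k]) w) *
      (along G (replace_at s) w - along G (replace_at (k :: s)) w)) =
    (fun w => along F (replace_at [::]) w * (along G (replace_at s) w - along G (replace_at (k :: s)) w) -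
      along F (replace_at [:: k]) w * (along G (replace_at s) w - along G (replace_at (k :: s)) w)).
    by apply/funext => w; ring.
  rewrite ExB; last 2 first.
  - by apply: mom2M; [|apply: mom2B]; auto using replace_at_inj.
  - by apply: mom2M; [|apply: mom2B]; auto using replace_at_inj.
  by rewrite -/V -[in RHS](opprK (Ex P (fun w => along F (replace_at [:: k]) w * _))) -VN opprK; field.
have Geq : Num.sqrt (Ex P (fun w => (along G (replace_at s) w - along G (replace_at (k :: s)) w) ^+ 2)) =
    influence G k.
  rewrite /influence; congr Num.sqrt.
  rewrite (along_swap_sq s) //; congr Ex; apply/funext => w.
  have -> : swap_at s \o replace_at s = replace_at [::].
    by apply/funext => j; rewrite /replace_at /=; case: ifP => /= ->.
  have -> : swap_at s \o replace_at (k :: s) = replace_at [:: k].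
    apply/funext => j; rewrite /replace_at /= !inE.
    case: eqP => [->|] /=; first by rewrite (negbTE ks).
    by case: ifP => /= ->.
  by [].
rewrite V2 normrM (@ger0_norm _ 2^-1) // ler_wpM2r // -Geq.
by apply: cauchy_schwarz; apply: mom2B; auto using replace_at_inj.
Qed.

(** Telescoping [one_swap] over the innovations in [s]. *)
Lemma replacement_bound F G s :
  measurable_fun setT F -> measurable_fun setT G ->
  moment P 2 (along F (replace_at [::])) -> moment P 2 (along G (replace_at [::])) -> uniq s ->
  `|Ex P (fun w => along F (replace_at [::]) w * (along G (replace_at [::]) w - along G (replace_at s) w))|
  <= \sum_(k <- s) influence F k * influence G k / 2.
Proof.
move=> mF mG F2 G2; elim: s => [_|k s ih /= /andP[ks us]].
  rewrite big_nil (_ : (fun _ => _) = fun=> 0) ?Ex_cst ?normr0 //.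
  by apply/funext => w; rewrite subrr mulr0.
have G2' a : injective a -> moment P 2 (along G a).
  by move=> ai; exact: (mom_along mG (@replace_at_inj [::]) ai G2).
rewrite big_cons addrC.
have -> : (fun w => along F (replace_at [::]) w *
      (along G (replace_at [::]) w - along G (replace_at (k :: s)) w)) =
   (fun w => along F (replace_at [::]) w * (along G (replace_at [::]) w - along G (replace_at s) w) +
     along F (replace_at [::]) w * (along G (replace_at s) w - along G (replace_at (k :: s)) w)).
  by apply/funext => w; ring.
rewrite ExD; last 2 first.
- by apply: mom2M => //; apply: mom2B; auto using replace_at_inj.
- by apply: mom2M => //; apply: mom2B; auto using replace_at_inj.
by rewrite (le_trans (ler_normD _ _)) // lerD ?ih ?one_swap.
Qed.

End EfronStein.
End Coupling.

(** * Distant innovations are asymptotically irrelevant *)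

Section Vanishing.
Context {d : measure_display} {T : measurableType d} {R : realType}
  {P : probability T R}.

(** Measurability is included so that vanishing sequences are stable under
    inclusion, union and approximation. *)
Definition vanishing (E : nat -> set T) :=
  (forall n, measurable (E n)) /\
  forall e : R, 0 < e -> \forall n \near \oo, (P (E n) <= e%:E)%E.

Lemma vanishing_sub (E E' : nat -> set T) : (forall n, measurable (E n)) ->
  (forall n, E n `<=` E' n) -> vanishing E' -> vanishing E.
Proof.
move=> mE sE [mE' v]; split => // e e0.
near=> n; apply: (@le_trans _ _ (P (E' n))).
  by apply: le_measure; rewrite ?inE.
by near: n; exact: v.
Unshelve. all: by end_near. Qed.

Lemma vanishingU (E E' : nat -> set T) : vanishing E -> vanishing E' ->
  vanishing (fun n => E n `|` E' n).
Proof.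
move=> [mE v] [mE' v']; split=> [n|e e0]; first exact: measurableU.
have e2 : 0 < e / 2 by rewrite divr_gt0.
near=> n; apply: (le_trans (measureU2 _ (mE n) (mE' n))).
rewrite [e]splitr EFinD leeD //; near: n; [exact: v|exact: v'].
Unshelve. all: by end_near. Qed.

Lemma vanishing0 : vanishing (fun=> set0).
Proof. by split => // e e0; near=> n; rewrite measure0 lee_fin ltW.
Unshelve. all: by end_near. Qed.

Lemma vanishing_bigU (E : nat -> nat -> set T) (K : nat) :
  (forall i, vanishing (E i)) -> vanishing (fun n => \bigcup_(i < K) E i n).
Proof.
move=> v; elim: K => [|K ih].
  by under eq_fun do rewrite bigcup_mkord big_ord0; exact: vanishing0.
have -> : (fun n => \bigcup_(i < K.+1) E i n) =
    (fun n => (\bigcup_(i < K) E i n) `|` E K n).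
  by apply/funext => n; rewrite !bigcup_mkord big_ord_recr.
exact: vanishingU.
Qed.

(** Interchange of limits: an error that is small uniformly in [n] may be
    discarded. *)
Lemma vanishing_approx (E : nat -> set T) :
  (forall n, measurable (E n)) ->
  (forall e : R, 0 < e -> exists (E1 E2 : nat -> set T),
     [/\ vanishing E1, (forall n, measurable (E2 n)),
         (forall n, (P (E2 n) <= e%:E)%E) & forall n, E n `<=` E1 n `|` E2 n]) ->
  vanishing E.
Proof.
move=> mE h; split => // e e0.
have e2 : 0 < e / 2 by rewrite divr_gt0.
have [E1 [E2 [[mE1 v1] mE2 PE2 EE]]] := h _ e2.
near=> n; apply: (@le_trans _ _ (P (E1 n `|` E2 n))).
  by apply: le_measure; rewrite ?inE //; exact: measurableU.
apply: (le_trans (measureU2 _ (mE1 n) (mE2 n))).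
by rewrite [e]splitr EFinD leeD ?PE2 //; near: n; exact: v1.
Unshelve. all: by end_near. Qed.

End Vanishing.

Section Tail.
Context {d : measure_display} {T : measurableType d} {R : realType}
  {P : probability T R}.
Variables (X : int + int -> {RV P >-> R}) (iidX : iid X).

Local Notation path J := (g_sigma_algebraType (@cylinders R J)).

Definition window (N : nat) : seq int :=
  [seq i%:Z - N%:Z | i <- iota 0 N.*2.+1].

Lemma window_uniq N : uniq (window N).
Proof. by rewrite map_inj_uniq ?iota_uniq // => i j; lia. Qed.

Lemma mem_window N (k : int) : (`|k| <= N)%N -> k \in window N.
Proof.
move=> kN; apply/mapP; exists (absz (k + N%:Z)); last by lia.
by rewrite mem_iota; lia.
Qed.

Definition flip (i : int + int) : int + int :=
  match i with inl k => inr k | inr k => inl k end.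

Lemma flip_inj : injective flip.
Proof. by case=> k [] j //= [->]. Qed.

(** Up to the global exchange [flip], replacing a window of innovations amounts to
    keeping that window and replacing everything else. *)
Definition keep_window (N : nat) : int -> int + int := flip \o replace_at (window N).

Lemma keep_window_inj N : injective (keep_window N).
Proof. by apply: inj_comp; [exact: flip_inj|exact: replace_at_inj]. Qed.

Let pre (a : int -> int + int) (A : set (path int)) := subpath X a @^-1` A.

Let mpre a A : measurable A -> measurable (pre a A).
Proof. by move=> mA; rewrite -[X in measurable X]setTI; exact: measurable_subpath. Qed.

Definition tail_change (A : set (path int)) (N : nat) : set T :=
  (pre (replace_at [::]) A `\` pre (keep_window N) A) `|` (pre (keep_window N) A `\` pre (replace_at [::]) A).

Let stable (A : set (path int)) := measurable A /\ vanishing (P := P) (tail_change A).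

Let measurable_tail_change A N : measurable A -> measurable (tail_change A N).
Proof. by move=> mA; apply: measurableU; apply: measurableD; exact: mpre. Qed.

Let stable_cylinder A : @cylinders R int A -> stable A.
Proof.
move=> [k [B [mB ->]]].
have mA : measurable ([set x : int -> R | B (x k)] : set (path int)).
  by apply: sub_sigma_algebra; exists k, B.
split => //; split; first by move=> N; exact: measurable_tail_change.
move=> e e0; near=> N.
have kN : k \in window N by apply: mem_window; near: N; exact: nbhs_infty_ge.
rewrite (_ : tail_change _ _ = set0) ?measure0 ?lee_fin ?ltW //.
apply/seteqP; split => // w; rewrite /tail_change /pre /subpath /keep_window /replace_at /=.
by rewrite kN /=; case=> -[].
Unshelve. all: by end_near. Qed.

Let stableC A : stable A -> stable (setT `\` A).
Proof.
move=> [mA vA]; split; first exact: measurableD.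
apply: vanishing_sub vA => N; first by apply: measurable_tail_change; exact: measurableD.
by move=> w [[[_ h1] h2]|[[_ h1] h2]]; [right|left]; split=> //; apply: contrapT;
  move=> h; apply: h2.
Qed.

Let stableU A B : stable A -> stable B -> stable (A `|` B).
Proof.
move=> [mA vA] [mB vB]; split; first exact: measurableU.
apply: vanishing_sub (vanishingU vA vB) => N.
  by apply: measurable_tail_change; exact: measurableU.
move=> w [[[h1|h1] h2]|[[h1|h1] h2]].
- by left; left; split => // h; apply: h2; left.
- by right; left; split => // h; apply: h2; right.
- by left; right; split => // h; apply: h2; left.
- by right; right; split => // h; apply: h2; right.
Qed.

Let stable_bigU (A : nat -> set (path int)) n :
  (forall i, stable (A i)) -> stable (\bigcup_(i < n) A i).
Proof.
move=> sA; elim: n => [|n ih].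
  rewrite bigcup_mkord big_ord0; split => //.
  apply: vanishing_sub (vanishing0 (P := P)) => N; first exact: measurable_tail_change.
  by move=> w [[]|[]].
by rewrite bigcup_mkord big_ord_recr /=; rewrite bigcup_mkord in ih; exact: stableU.
Qed.

Let stable_bigcup (A : nat -> set (path int)) :
  (forall i, stable (A i)) -> stable (\bigcup_i A i).
Proof.
move=> sA; have mA i : measurable (A i) by case: (sA i).
have mU := bigcup_measurable (fun i (_ : setT i) => mA i).
split => //; apply: vanishing_approx => [N|e e0]; first exact: measurable_tail_change.
pose U n := \bigcup_(i < n) A i; pose V := \bigcup_i A i.
have mUn n : measurable (U n) by exact: bigcup_measurable.
have mR n : measurable (V `\` U n) by exact: measurableD.
have [n Pn] : exists n, (P (pre (replace_at [::]) (V `\` U n)) <= (e / 2)%:E)%E.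
  have : P (pre (replace_at [::]) (V `\` U n)) @[n --> \oo] -->
      P (\bigcap_n pre (replace_at [::]) (V `\` U n)).
    apply: nonincreasing_cvg_mu.
    - by rewrite -ge0_fin_numE // fin_num_measure //; exact: mpre.
    - by move=> i; exact: mpre.
    - by apply: bigcapT_measurable => i; exact: mpre.
    - move=> i j ij; apply/subsetPset => w [h1 h2]; split => // -[k /= ki Ak].
      by apply: h2; exists k => //=; exact: leq_trans ij.
  rewrite (_ : \bigcap_n _ = set0); last first.
    apply/seteqP; split => // w h; have [[k _ Ak] _] := h 0%N I.
    by have [_] := h k.+1 I; apply; exists k => //=.
  rewrite measure0 => /fine_cvgP[fP /cvgrPdist_le /(_ (e / 2))].
  rewrite divr_gt0 // => /(_ isT) h.
  near \oo => n; exists n.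
  have nf : P (pre (replace_at [::]) (V `\` U n)) \is a fin_num by near: n.
  rewrite -(fineK nf) lee_fin (le_trans (ler_norm _)) // -normrN.
  by rewrite -[X in `|X|]add0r; near: n.
exists (tail_change (U n)), (fun N => pre (replace_at [::]) (V `\` U n) `|` pre (keep_window N) (V `\` U n)).
split.
- by have [] := stable_bigU n sA.
- by move=> N; apply: measurableU; exact: mpre.
- move=> N; apply: (le_trans (measureU2 _ _ _)); try exact: mpre.
  have Pn' : (P (pre (keep_window N) (V `\` U n)) <= (e / 2)%:E)%E.
    apply: le_trans Pn; rewrite le_eqVlt; apply/orP; left; apply/eqP.
    exact: (iid_subpath_law iidX (@keep_window_inj N) (@replace_at_inj [::]) (mR n)).
  by rewrite [e]splitr EFinD leeD.
- move=> N w; rewrite /tail_change /pre /=.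
  have UV : U n `<=` V by move=> x [k _ Ak]; exists k.
  case=> -[h1 h2].
    have [h|h] := pselect (U n (subpath X (replace_at [::]) w)).
      by left; left; split => // /UV.
    by right; left.
  have [h|h] := pselect (U n (subpath X (keep_window N) w)).
    by left; right; split => // /UV.
  by right; right.
Unshelve. all: by end_near. Qed.

(** Cylinders are unaffected as soon as the window contains their index, and the
    sets with this property form a sigma-algebra.  For a countable union, the
    part not covered by finitely many sets is small along both paths at once,
    since the two paths have the same law. *)
Lemma stable_measurable A : measurable A -> vanishing (P := P) (tail_change A).
Proof.
suff h : <<s @cylinders R int >> `<=` stable by move=> /h[].
apply: smallest_sub; last exact: stable_cylinder.
split.
- split; first exact: measurable0.
  apply: vanishing_sub (vanishing0 (P := P)) => N; first exact: measurable_tail_change.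
  by move=> w [[]|[]].
- exact: stableC.
- exact: stable_bigcup.
Qed.

(** If [G] changes by more than [e] while one of its two values is bounded by [M],
    then the two paths are separated by one of the finitely many level sets
    [G > - M + i * e], to which [stable_measurable] applies. *)
Lemma tail_in_probability (G : path int -> R) : measurable_fun setT G ->
  moment P 2 (along X G (replace_at [::])) -> forall e : R, 0 < e ->
  vanishing (P := P) (fun N =>
    [set w | e < `|along X G (keep_window N) w - along X G (replace_at [::]) w|]).
Proof.
move=> mG G2 e e0.
have mal a : measurable_fun setT (along X G a).
  by apply: measurableT_comp => //; exact: measurable_subpath.
apply: vanishing_approx => [N|e' e'0]; first by apply: measurable_abs_gt; exact: measurable_funB.
pose c := Ex P (fun w => along X G (replace_at [::]) w ^+ 2).
have c0 : 0 <= c by apply: Ex_ge0 => w; exact: sqr_ge0.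
pose M := 1 + 2 * c / e'.
have M1 : 1 <= M by rewrite lerDl divr_ge0 ?mulr_ge0 // ltW.
have M0 : 0 < M by exact: lt_le_trans M1.
have cM : c / M ^+ 2 <= e' / 2.
  rewrite ler_pdivrMr ?exprn_gt0 //.
  have : 2 * c / e' <= M by rewrite lerDr.
  rewrite ler_pdivrMr // => h; have : M <= M ^+ 2 by rewrite expr2 ler_peMr // ltW.
  have : M * e' <= M ^+ 2 * e' by rewrite ler_pM2r // expr2 ler_peMr // ltW.
  lra.
pose lev (i : nat) : set (path int) := [set x | - M + i%:R * e < G x].
have mlev i : measurable (lev i).
  have := mG measurableT `](- M + i%:R * e), +oo[%classic (measurable_itv _).
  rewrite setTI; congr (measurable _); apply/seteqP; split => w /=;
  by rewrite in_itv /= andbT.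
pose K := (Num.truncn (2 * M / e)).+2.
(* large values of [G] are discarded by Chebyshev, with the same bound along both paths *)
exists (fun N => \bigcup_(i < K) tail_change (lev i) N),
  (fun N => [set w | M < `|along X G (replace_at [::]) w|] `|` [set w | M < `|along X G (keep_window N) w|]).
split.
- by apply: vanishing_bigU => i; exact: stable_measurable.
- by move=> N; apply: measurableU; exact: measurable_abs_gt.
- move=> N; apply: (le_trans (measureU2 _ _ _)); try exact: measurable_abs_gt.
  rewrite [e']splitr EFinD leeD //.
    by apply: (le_trans (markov_sq M0 _)) => //; rewrite lee_fin.
  have G2' : moment P 2 (along X G (keep_window N)).
    by apply: (mom_along iidX mG (@replace_at_inj [::])) => //; exact: keep_window_inj.
  apply: (le_trans (markov_sq M0 G2')) => //; rewrite lee_fin.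
  rewrite (_ : Ex _ _ = c) //.
  apply: (Ex_law iidX (H := fun x => G x ^+ 2)).
  - exact: measurable_funX.
  - exact: keep_window_inj.
  - exact: replace_at_inj.
- move=> N w /=.
  set x := along X G (keep_window N) w; set y := along X G (replace_at [::]) w => xy.
  have [yM|yM] := ltP M `|y|; first by right; left.
  have [xM|xM] := ltP M `|x|; first by right; right.
  have key u v : `|u| <= M -> u + e < v -> exists2 i, (i < K)%N &
      (u <= - M + i%:R * e) && (- M + i%:R * e < v).
    move=> uM uv; exists (Num.truncn ((u + M) / e)).+1.
      rewrite ltnS ltnS; apply: le_truncn; rewrite ler_pM2r ?invr_gt0 //.
      by have := ler_norml u M; rewrite uM => /esym/andP[]; lra.
    have uM0 : 0 <= (u + M) / e.
      apply: divr_ge0; last exact: ltW.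
      by have := ler_norml u M; rewrite uM => /esym/andP[]; lra.
    have /andP[t1 t2] := truncn_itv uM0.
    move: t1 t2; rewrite ler_pdivlMr // ltr_pdivrMr // => t1 t2.
    apply/andP; split; first lra.
    by move: t1; rewrite -natr1; lra.
  left; have [xy'|xy'] := ltP (x + e) y.
    have [i iK /andP[h1 h2]] := key _ _ xM xy'.
    exists i => //; left; split => //=; rewrite /lev /=.
    by move=> h; move: h1; rewrite leNgt => /negP.
  have yx : y + e < x by move: xy; case: (ger0P (x - y)) => h xy; lra.
  have [i iK /andP[h1 h2]] := key _ _ yM yx.
  exists i => //; right; split => //=; rewrite /lev /=.
  by move=> h; move: h1; rewrite leNgt => /negP.
Qed.

(** After all innovations are exchanged with their copies, the first factor
    depends on the copies only, whereas the second one tends in L2 to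
    [G] of the original innovations, which is independent of it and centred. *)
Lemma replacement_limit (F G : path int -> R) :
  measurable_fun setT F -> measurable_fun setT G ->
  moment P 2 (along X F (replace_at [::])) -> moment P 4 (along X G (replace_at [::])) ->
  Ex P (along X G (replace_at [::])) = 0 ->
  forall e, 0 < e -> \forall N \near \oo,
  `|Ex P (fun w => along X F (replace_at [::]) w * along X G (replace_at (window N)) w)| <= e.
Proof.
move=> mF mG F2 G4 G0 e e0.
pose D N w := along X G (keep_window N) w - along X G (replace_at [::]) w.
have G4' N : moment P 4 (along X G (keep_window N)).
  by apply: (mom_along iidX mG (@replace_at_inj [::])) => //; exact: keep_window_inj.
have D4 N : moment P 4 (D N) by exact: mom4B.
pose c := Ex P (fun w => along X F (replace_at [::]) w ^+ 2).
have c0 : 0 <= c by apply: Ex_ge0 => w; exact: sqr_ge0.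
have inr_inj : injective (flip \o replace_at [::]).
  by apply: inj_comp; [exact: flip_inj|exact: replace_at_inj].
have cE : Ex P (fun w => along X F (flip \o replace_at [::]) w ^+ 2) = c.
  apply: (Ex_law iidX (H := fun x => F x ^+ 2)) => //; last exact: replace_at_inj.
  exact: measurable_funX.
have F2' : moment P 2 (along X F (flip \o replace_at [::])).
  by apply: (mom_along iidX mF (@replace_at_inj [::])).
have flipE N : Ex P (fun w => along X F (replace_at [::]) w * along X G (replace_at (window N)) w) =
    Ex P (fun w => along X F (flip \o replace_at [::]) w * D N w).
  transitivity (Ex P (fun w => along X F (flip \o replace_at [::]) w * along X G (keep_window N) w)).
    pose H (x : path (int + int)%type) : R :=
      F (fun k => x (replace_at [::] k)) * G (fun k => x (replace_at (window N) k)).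
    have mH : measurable_fun setT H.
      by apply: measurable_funM; exact: measurable_comp_reindex.
    exact: (Ex_law iidX mH (@inj_id _) flip_inj).
  rewrite -[LHS]subr0 -(_ : Ex P (fun w => along X F (flip \o replace_at [::]) w *
      along X G (replace_at [::]) w) = 0); last first.
    apply: indep_Ex0 => //; first exact: mom42.
    move=> A B mA mB.
    apply: (indep_subpath (X := X) (proj1 iidX) inr_inj (@replace_at_inj [::]) _
      (C := F @^-1` A) (C' := G @^-1` B)) => //.
      by rewrite -[X in measurable X]setTI; exact: mF.
    by rewrite -[X in measurable X]setTI; exact: mG.
  rewrite -ExB; last 2 first.
  - by apply: mom2M => //; exact: mom42.
  - by apply: mom2M => //; exact: mom42.
  by congr Ex; apply/funext => w; rewrite /D mulrBr.
pose e2 := (e / (1 + Num.sqrt c)) ^+ 2.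
have e20 : 0 < e2 by rewrite exprn_gt0 // divr_gt0 // ltr_wpDr ?sqrtr_ge0.
have [M DM] : exists M, forall N, Ex P (fun w => D N w ^+ 4) <= M.
  exists (8 * (Ex P (fun w => along X G (replace_at [::]) w ^+ 4) +
    Ex P (fun w => along X G (replace_at [::]) w ^+ 4))) => N.
  rewrite -[X in 8 * (X + _)](Ex_law iidX (H := fun x => G x ^+ 4) (p := keep_window N)); last 3 first.
  - exact: measurable_funX.
  - exact: keep_window_inj.
  - exact: replace_at_inj.
  have [_ i1] := G4; have [_ i2] := G4' N; have [_ i3] := D4 N.
  rewrite -ExD // -ExZ; last exact: L1D.
  apply: Ex_le => //; first by apply: L1Z; exact: L1D.
  move=> w; rewrite /D /along; set a := G _; set b := G _.
  have := sqr_ge0 (a ^+ 2 - b ^+ 2); have := sqr_ge0 (a + b).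
  nra.
have DP e' : 0 < e' -> \forall N \near \oo, (P [set w | (e' < `|D N w|)%R] <= e'%:E)%E.
  by move=> e'0; have [_] := tail_in_probability mG (mom42 G4) e'0; apply.
near=> N; rewrite flipE.
apply: (le_trans (cauchy_schwarz F2' (mom42 (D4 N)))); rewrite cE.
have : Ex P (fun w => D N w ^+ 2) <= e2.
  by near: N; exact: (prob_to_L2 D4 DM DP).
move=> /ler_wsqrtr/(ler_wpM2l (sqrtr_ge0 c))/le_trans; apply.
rewrite /e2 sqrtr_sqr ger0_norm ?divr_ge0 ?addr_ge0 ?sqrtr_ge0 ?(ltW e0) //.
rewrite mulrA ler_pdivrMr ?ltr_wpDr ?sqrtr_ge0 //.
by rewrite mulrC mulrDr mulr1 lerDr ltW.
Unshelve. all: by end_near. Qed.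

End Tail.

(** * Norms and convolution sums *)

Section Norms.
Context {d : measure_display} {T : measurableType d} {R : realType}
  {P : probability T R}.
Implicit Types f g : T -> R.

Definition L2norm f : R := Num.sqrt (Ex P (fun w => f w ^+ 2)).

Lemma L2norm_ge0 f : 0 <= L2norm f. Proof. exact: sqrtr_ge0. Qed.

Lemma L2norm_sq f : L2norm f ^+ 2 = Ex P (fun w => f w ^+ 2).
Proof. by rewrite sqr_sqrtr //; apply: Ex_ge0 => w; exact: sqr_ge0. Qed.

Lemma L2norm_0 : L2norm (fun=> 0) = 0.
Proof.
rewrite /L2norm (_ : (fun _ => _) = fun=> 0) ?Ex_cst ?sqrtr0 //.
by apply/funext => w; rewrite expr0n.
Qed.

Lemma L2normZ c f : moment P 2 f -> L2norm (fun w => c * f w) = `|c| * L2norm f.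
Proof.
move=> [mf fi]; rewrite /L2norm; under eq_fun do rewrite exprMn.
by rewrite ExZ // sqrtrM ?sqr_ge0 // sqrtr_sqr.
Qed.

Lemma momD k f g : (k = 2%N \/ k = 4%N) -> moment P k f -> moment P k g ->
  moment P k (fun w => f w + g w).
Proof.
move=> k24 hf hg; have hg' := momZ (-1) hg.
have -> : (fun w => f w + g w) = (fun w => f w - (-1) * g w).
  by apply/funext => w; rewrite mulN1r opprK.
by move: k24 hf hg'=> [] ->; [exact: mom2B|exact: mom4B].
Qed.

Lemma mom_sum (I : Type) (r : seq I) k (f : I -> T -> R) :
  (k = 2%N \/ k = 4%N) -> (forall i, moment P k (f i)) ->
  moment P k (fun w => \sum_(i <- r) f i w).
Proof.
move=> k24 h; elim: r => [|i r ih].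
  under eq_fun do rewrite big_nil.
  by split => //; exact: L1_cst.
under eq_fun do rewrite big_cons.
exact: momD.
Qed.

Lemma L2normD f g : moment P 2 f -> moment P 2 g ->
  L2norm (fun w => f w + g w) <= L2norm f + L2norm g.
Proof.
move=> f2 g2; have [[_ fi] [_ gi]] := (f2, g2).
rewrite -[leRHS]ger0_norm ?addr_ge0 ?L2norm_ge0 // -sqrtr_sqr ler_wsqrtr //.
have -> : (fun w => (f w + g w) ^+ 2) =
    (fun w => (f w ^+ 2 + 2 * (f w * g w)) + g w ^+ 2).
  by apply/funext => w; ring.
have fg := mom2M f2 g2.
rewrite ExD ?ExD ?ExZ //; try (try exact: L1D; exact: L1Z).
  have := cauchy_schwarz f2 g2; rewrite -/(L2norm f) -/(L2norm g).
  have := ler_norm (Ex P (fun w => f w * g w)).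
  rewrite -!L2norm_sq sqrrD -mulr_natl; lra.
by apply: L1D => //; exact: L1Z.
Qed.

Lemma L2norm_sum (I : Type) (r : seq I) (f : I -> T -> R) :
  (forall i, moment P 2 (f i)) ->
  L2norm (fun w => \sum_(i <- r) f i w) <= \sum_(i <- r) L2norm (f i).
Proof.
move=> h; elim: r => [|i r ih].
  by under eq_fun do rewrite big_nil; rewrite L2norm_0 big_nil.
under eq_fun do rewrite big_cons.
rewrite big_cons.
have h2 : moment P 2 (fun w => \sum_(j <- r) f j w) by apply: mom_sum => //; left.
by apply: (le_trans (L2normD (h i) h2)); rewrite lerD2l.
Qed.

Lemma mom4_Lnorm q f : 4 < q -> measurable_fun setT f ->
  ('N[P]_(q%:E) [EFin \o f] < +oo)%E -> moment P 4 f.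
Proof.
move=> q4 mf fq; split => //.
have q1 : (1 <= q%:E)%E by rewrite lee_fin; lra.
have fL : f \in Lfun P q%:E by rewrite inE /=; apply/andP; split; rewrite inE.
have f4 : f \in Lfun P 4%:E.
  apply: (Lfun_subset _ q1) fL; rewrite ?lee_fin ?(ltW q4) //; first lra.
  exact: fin_num_measure.
have i4 : 1 <= 4 :> R by lra.
have := Lfun_integrable i4 f4; rewrite /L1; congr (_.-integrable _ _).
apply/funext => w; rewrite powR_mulrn //; congr EFin.
by rewrite -normrX ger0_norm // exprn_even_ge0.
Qed.

(** Hoelder with exponent [q / 2] against the constant one. *)
Lemma L2norm_le_Lnorm q f : 4 < q -> moment P 2 f ->
  ((L2norm f)%:E <= 'N[P]_(q%:E) [EFin \o f])%E.
Proof.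
move=> q4 [mf fi].
have q0 : 0 < q by lra.
have p0 : 0 < q / 2 by lra.
have p'0 : 0 < (1 - (q / 2)^-1)^-1.
  by rewrite invr_gt0 subr_gt0 invf_lt1; lra.
have H := @hoelder _ T R P (fun w => f w ^+ 2) (fun=> 1) (q / 2)
  (1 - (q / 2)^-1)^-1 (measurable_funX _ mf) (measurable_cst _) p0 p'0.
have : ('N[P]_1[EFin \o ((fun w => f w ^+ 2) \* (fun=> 1))%R] <=
    'N[P]_(q / 2)%:E[EFin \o (fun w => f w ^+ 2)%R])%E.
  apply: (le_trans (H _)); first by rewrite invrK; ring.
  rewrite (_ : EFin \o (fun=> 1) = cst 1%E) // Lnorm_cst1.
  by have /= -> := probability_setT P; rewrite poweR1r mule1.
have -> : ('N[P]_1[EFin \o ((fun w => f w ^+ 2) \* (fun=> 1))%R] = (L2norm f ^+ 2)%:E)%E.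
  rewrite Lnorm1 L2norm_sq Ex_EFin //; apply: eq_integral => w _ /=.
  by rewrite mulr1 ger0_norm // sqr_ge0.
have -> : ('N[P]_(q / 2)%:E[EFin \o (fun w => f w ^+ 2)%R] =
    'N[P]_q%:E[EFin \o f] `^ 2)%E.
  rewrite unlock -poweRrM.
  have -> : (q / 2)^-1 = q^-1 * 2 by field; rewrite gt_eqF.
  congr (_ `^ _)%E; apply: eq_integral => w _ /=; congr EFin.
  by rewrite normrX -powR_mulrn // -powRrM mulrC divfK.
have := Lnorm_ge0 P q%:E (EFin \o f).
case: ('N[P]_q%:E[EFin \o f])%E => [n| |]; [|by move=> _ _; rewrite leey|by []].
rewrite !lee_fin => n0; rewrite powR_mulrn //.
by rewrite ler_sqr ?nnegrE ?L2norm_ge0.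
Qed.

End Norms.

(** Cauchy-Schwarz with respect to the weights [c]. *)
Lemma weighted_sum_sq (R : realType) (I : Type) (r : seq I) (a c : I -> R) :
  (forall i, 0 <= c i) ->
  (\sum_(i <- r) a i * c i) ^+ 2 <= (\sum_(i <- r) a i ^+ 2 * c i) * \sum_(i <- r) c i.
Proof.
move=> c0; elim: r => [|i r]; first by rewrite !big_nil expr0n mulr0.
rewrite !big_cons.
have B0 : 0 <= \sum_(j <- r) c j by exact: sumr_ge0.
have A0 : 0 <= \sum_(j <- r) a j ^+ 2 * c j.
  by apply: sumr_ge0 => j _; rewrite mulr_ge0 ?sqr_ge0.
move: (\sum_(j <- r) a j * c j) (\sum_(j <- r) c j) B0
  (\sum_(j <- r) a j ^+ 2 * c j) A0 => x B B0 A A0 xAB.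
have := c0 i; move: (c i) (a i) => t u t0.
have k : 2 * x * u <= A + u ^+ 2 * B.
  have y0 : 0 <= A + u ^+ 2 * B by rewrite addr_ge0 // mulr_ge0 ?sqr_ge0.
  apply: (le_trans (ler_norm _)).
  rewrite -[leRHS]ger0_norm // -ler_sqr ?nnegrE // !real_normK ?num_real //.
  have := sqr_ge0 (A - u ^+ 2 * B); have := ler_wpM2l (sqr_ge0 u) xAB.
  lra.
have := ler_wpM2l t0 k; lra.
Qed.

(** Young: convolution with a summable sequence is bounded on square-summable
    ones. *)
Lemma convolution_bound (R : realType) (c : int -> R) (Th : R)
    (w : nat -> R) (r : seq nat) (l : seq int) :
  (forall j, 0 <= c j) -> (forall s, uniq s -> \sum_(j <- s) c j <= Th) ->
  uniq r -> uniq l ->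
  \sum_(k <- l) (\sum_(t <- r) w t * c (t%:Z - k)) ^+ 2 <=
  Th ^+ 2 * \sum_(t <- r) w t ^+ 2.
Proof.
move=> c0 cT ur ul.
have T0 : 0 <= Th by apply: le_trans (cT [::] isT); rewrite big_nil.
apply: (@le_trans _ _ (\sum_(k <- l) \sum_(t <- r) w t ^+ 2 * c (t%:Z - k) * Th)).
  apply: ler_sum => k _; apply: (le_trans (weighted_sum_sq _ _ _)) => //.
  rewrite -mulr_suml ler_wpM2l //.
    by apply: sumr_ge0 => t _; rewrite mulr_ge0 ?sqr_ge0.
  rewrite -(big_map (fun t : nat => t%:Z - k) predT c); apply: cT.
  by rewrite map_inj_uniq // => i j; lia.
rewrite exchange_big /= mulr_sumr; apply: ler_sum => t _.
rewrite -mulr_suml -mulr_sumr.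
have h : \sum_(k <- l) c (t%:Z - k) <= Th.
  rewrite -(big_map (fun k : int => t%:Z - k) predT c); apply: cT.
  by rewrite map_inj_uniq // => i j; lia.
have := ler_wpM2r T0 (ler_wpM2l (sqr_ge0 (w t)) h); lra.
Qed.

(** * Second moment of a weighted sum of the noise *)

Section Noise.
Context {d : measure_display} {T : measurableType d} {R : realType}
  {P : probability T R}.
Variables (eps eta eta' : int -> {RV P >-> R}) (filt : (int -> R) -> R)
  (q tail : R) (t0 : nat).
Hypotheses (mean_eps : forall t, ('E_P[eps t] = 0)%E)
  (meas_filt : measurable_filter filt)
  (eps_filt : forall t w, eps t w = filtered filt eta t w)
  (q_gt4 : 4 < q)
  (mom_eps : forall t, ('N[P]_(q%:E) [EFin \o eps t] < +oo)%E)
  (copy_eta : iid_copy eta eta')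
  (dep_eps : (dependence_tail q filt eta eta' t0 <= tail%:E)%E).

Local Notation path J := (g_sigma_algebraType (@cylinders R J)).

Let X (s : int + int) : {RV P >-> R} :=
  match s with inl i => eta i | inr i => eta' i end.

Let shifted (t : int) (x : path int) : R := filt (fun k => x (t + k)).

Let measurable_shifted t : measurable_fun setT (shifted t).
Proof. exact: (@measurable_comp_reindex R int int (fun k => t + k) filt meas_filt). Qed.

Let along_shifted t : along X (shifted t) (replace_at [::]) = eps t.
Proof. by apply/funext => w; rewrite eps_filt. Qed.

Let along_coupled t : along X (shifted t) (replace_at [:: 0]) = coupled filt eta eta' t.
Proof.
apply/funext => w; rewrite /along /shifted /coupled; congr filt.
by apply/funext => k; rewrite /subpath /replace_at inE; case: eqP => [->|].
Qed.

Let gap (t : int) : R := L2norm (P := P) (fun w => eps t w - coupled filt eta eta' t w).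

Let influence_shifted t k : influence X (shifted t) k = gap (t - k).
Proof.
rewrite /influence /gap /L2norm -along_shifted -along_coupled; congr Num.sqrt.
pose H (x : path (int + int)%type) : R :=
  (shifted (t - k) (fun j => x (replace_at [::] j)) - shifted (t - k) (fun j => x (replace_at [:: 0] j))) ^+ 2.
have mH : measurable_fun setT H.
  apply: measurable_funX.
  by apply: measurable_funB; apply: measurable_comp_reindex; exact: measurable_shifted.
pose sh (s : int + int) : int + int :=
  match s with inl i => inl (i + k) | inr i => inr (i + k) end.
have sh_inj : injective sh by case=> i [] j //= [] /addIr ->.
rewrite -[RHS](Ex_law (p := sh) copy_eta mH sh_inj (@inj_id _)).
congr Ex; apply/funext => w; rewrite /H /along /shifted /subpath.
congr ((_ - _) ^+ 2); congr filt; apply/funext => j; rewrite /replace_at /sh /= ?inE.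
  by rewrite (_ : t - k + j + k = t + j) //; ring.
rewrite (_ : (t + j == k) = (t - k + j == 0)); last first.
  by rewrite addrAC subr_eq0.
by case: ifP => _ /=; rewrite (_ : t - k + j + k = t + j) //; ring.
Qed.

Let mom4_eps t : moment P 4 (eps t).
Proof. exact: mom4_Lnorm q_gt4 _ (mom_eps t). Qed.

Let mom_shifted k t a : (k = 2%N \/ k = 4%N) -> injective a ->
  moment P k (along X (shifted t) a).
Proof.
move=> k24 ai.
apply: (mom_along copy_eta (measurable_shifted t) (@replace_at_inj [::]) ai).
rewrite along_shifted; move: k24 => [] ->; last exact: mom4_eps.
exact/mom42/mom4_eps.
Qed.

Let gap_le t : ((gap t)%:E <= dependence_coef q filt eta eta' t)%E.
Proof.
rewrite /dependence_coef (_ : filtered filt eta t = eps t); last first.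
  by apply/funext => w; rewrite eps_filt.
apply: L2norm_le_Lnorm => //; rewrite -along_coupled -along_shifted.
by apply: mom2B; apply: mom_shifted; (try by left); exact: replace_at_inj.
Qed.

Let gap_summable : exists Th, forall s : seq int, uniq s ->
  \sum_(j <- s) gap j <= Th.
Proof.
pose small := window t0.
exists (\sum_(j <- small) gap j + tail) => s us.
have gap0 j : 0 <= gap j by exact: L2norm_ge0.
rewrite (bigID (fun j => j \in small)) /= lerD //.
  rewrite -big_filter; set l := [seq j <- s | _].
  have ul : uniq l by exact: filter_uniq.
  have sub : {subset l <= small} by move=> j; rewrite mem_filter => /andP[].
  rewrite (perm_big [seq j <- small | j \in l]) ?big_filter; last first.
    apply: uniq_perm => [||j]; [exact: ul|exact/filter_uniq/window_uniq|].
    by rewrite mem_filter; case: (boolP (j \in l)) => //= /sub ->.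
  by rewrite [leRHS](bigID (fun j => j \in l)) /= lerDl sumr_ge0.
rewrite -big_filter; set l := [seq j <- s | _].
have ul : uniq l by exact: filter_uniq.
rewrite -lee_fin (le_trans _ dep_eps) // -sumEFin.
apply: (@le_trans _ _ (\sum_(j <- l) dependence_coef q filt eta eta' j)%E).
  by apply: lee_sum => j _; exact: gap_le.
apply: esum_ge; exists [set` l]; last by rewrite -fsbig_seq.
split; first exact: finite_seq.
move=> j /=; rewrite mem_filter => /andP[h _].
by rewrite leqNgt; apply: contra h => h; apply: mem_window; exact: ltnW.
Qed.

(** The weighted sum [F] is its own partner in [replacement_bound].  Its influences
    are the convolution of the weights with the physical dependence measure, and
    the remaining expectation vanishes by [replacement_limit]. *)
Lemma noise_second_moment : exists2 C : R, 0 < C & forall (r : seq nat) (w : nat -> R),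
  uniq r -> moment P 2 (fun x => \sum_(t <- r) w t * eps t%:Z x) /\
  Ex P (fun x => (\sum_(t <- r) w t * eps t%:Z x) ^+ 2) <= C * \sum_(t <- r) w t ^+ 2.
Proof.
have [Th gapT] := gap_summable.
have gap0 j : 0 <= gap j by exact: L2norm_ge0.
exists (Th ^+ 2 + 1); first by rewrite ltr_wpDl // sqr_ge0.
move=> r w ur.
pose F (x : path int) : R := \sum_(t <- r) w t * shifted t%:Z x.
have mF : measurable_fun setT F.
  by apply: measurable_sum => t; apply: measurable_funM => //; exact: measurable_shifted.
have alongF a : along X F a =
    (fun x => \sum_(t <- r) w t * along X (shifted t%:Z) a x) by [].
have momF k a : (k = 2%N \/ k = 4%N) -> injective a -> moment P k (along X F a).
  move=> k24 ai; rewrite alongF; apply: mom_sum => // t; apply: momZ; exact: mom_shifted.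
have FE : along X F (replace_at [::]) = (fun x => \sum_(t <- r) w t * eps t%:Z x).
  by rewrite alongF; apply/funext => x; apply: eq_bigr => t _; rewrite along_shifted.
have F2 : moment P 2 (along X F (replace_at [::])) by apply: momF; [left|exact: replace_at_inj].
have F4 : moment P 4 (along X F (replace_at [::])) by apply: momF; [right|exact: replace_at_inj].
rewrite -FE; split => //.
have F0 : Ex P (along X F (replace_at [::])) = 0.
  rewrite FE; elim: {ur F mF alongF momF FE F2 F4} r => [|t r ih].
    under eq_fun do rewrite big_nil.
    by rewrite Ex_cst.
  under eq_fun do rewrite big_cons.
  have L1eps u : L1 P (eps u).
    have := mom2M (mom42 (mom4_eps u)) (mom2_cst P 1).
    by under eq_fun do rewrite mulr1.
  rewrite ExD ?ih ?addr0.
  - rewrite ExZ // (_ : Ex P (eps t) = 0) ?mulr0 //.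
    apply: EFin_inj; rewrite Ex_EFin //.
    by have := mean_eps t; rewrite unlock.
  - exact: L1Z.
  - have h2 : moment P 2 (fun x => \sum_(j <- r) w j * eps j%:Z x).
      by apply: mom_sum; [left|move=> j; apply: momZ; exact/mom42/mom4_eps].
    have := mom2M h2 (mom2_cst P 1).
    by under eq_fun do rewrite mulr1.
have infl k : influence X F k <= \sum_(t <- r) `|w t| * gap (t%:Z - k).
  rewrite (_ : influence X F k = L2norm (P := P) (fun x => \sum_(t <- r)
    w t * (along X (shifted t%:Z) (replace_at [::]) x - along X (shifted t%:Z) (replace_at [:: k]) x))).
    have h t : moment P 2 (fun x => along X (shifted t%:Z) (replace_at [::]) x -
        along X (shifted t%:Z) (replace_at [:: k]) x).
      by apply: mom2B; apply: mom_shifted; (try by left); exact: replace_at_inj.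
    apply: (le_trans (L2norm_sum _ _)) => [t|]; first exact: momZ.
    by apply: ler_sum => t _; rewrite L2normZ // -influence_shifted.
  rewrite /influence /L2norm; congr (Num.sqrt (Ex P _)); apply/funext => x.
  by rewrite !alongF -sumrB; congr (_ ^+ 2); apply: eq_bigr => t _; rewrite mulrBr.
have infl_sum l : uniq l ->
    \sum_(k <- l) influence X F k * influence X F k / 2 <= Th ^+ 2 * \sum_(t <- r) w t ^+ 2.
  move=> ul.
  have := convolution_bound (fun t => `|w t|) gap0 gapT ur ul.
  rewrite (_ : \sum_(t <- r) `|w t| ^+ 2 = \sum_(t <- r) w t ^+ 2); last first.
    by apply: eq_bigr => t _; rewrite real_normK ?num_real.
  apply: le_trans; apply: ler_sum => k _.
  have i0 : 0 <= influence X F k by exact: sqrtr_ge0.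
  have := infl k; nra.
apply/ler_addgt0Pr => e e0.
near \oo => N.
have lim : `|Ex P (fun x => along X F (replace_at [::]) x * along X F (replace_at (window N)) x)| <= e.
  by near: N; exact: (replacement_limit copy_eta mF mF F2 F4 F0).
have := replacement_bound (X := X) copy_eta mF mF F2 F2 (window_uniq N).
have F2N : moment P 2 (along X F (replace_at (window N))) by apply: momF; [left|exact: replace_at_inj].
have -> : (fun x => along X F (replace_at [::]) x *
    (along X F (replace_at [::]) x - along X F (replace_at (window N)) x)) =
  (fun x => along X F (replace_at [::]) x * along X F (replace_at [::]) x -
    along X F (replace_at [::]) x * along X F (replace_at (window N)) x).
  by apply/funext => x; rewrite mulrBr.
rewrite ExB; [|exact: mom2M..].
have := infl_sum _ (window_uniq N).
have sqE : Ex P (fun x => (\sum_(t <- r) w t * eps t%:Z x) ^+ 2) =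
    Ex P (fun x => along X F (replace_at [::]) x * along X F (replace_at [::]) x).
  by congr Ex; apply/funext => x; rewrite FE expr2.
move: lim; rewrite !ler_norml => /andP[l1 l2] s1 /andP[s2 s3].
have w0 : 0 <= \sum_(t <- r) w t ^+ 2 by apply: sumr_ge0 => t _; exact: sqr_ge0.
lra.
Unshelve. all: by end_near. Qed.

End Noise.

(** * Increments of a continuously differentiable function *)

Section UnitC1.
Context {R : realType}.
Variables (f f' : R -> R).
Hypothesis fC1 : C1_on_unit f f'.

(** The one-sided derivatives at 0 and 1 and the two-sided ones in between are
    all contained in this first-order expansion. *)
Lemma C1_on_unit_linear (z e : R) : z \in `[0, 1] -> 0 < e ->
  exists2 delta : R, 0 < delta & forall y, y \in `[0, 1] -> `|y - z| < delta ->
    `|f y - f z - f' z * (y - z)| <= e * `|y - z|.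
Proof.
move=> z01 e0; have [/(_ z z01)/cvgrPdist_le/(_ e e0) h _] := fC1.
move: h; rewrite near_withinE => /nbhs_ballP[delta /= d0 h].
exists delta => // y y01 yz.
have [->|yz0] := eqVneq y z; first by rewrite !subrr mulr0 subrr normr0 mulr0.
have := h y; rewrite /ball /= distrC => /(_ yz yz0 y01).
have yz1 : y - z != 0 by rewrite subr_eq0.
have -> : f y - f z - f' z * (y - z) = - (f' z - (f y - f z) / (y - z)) * (y - z).
  by field.
by rewrite normrM normrN => h'; rewrite ler_wpM2r.
Qed.

Lemma C1_on_unit_is_derive (z : R) : z \in `]0, 1[ -> is_derive z 1 f (f' z).
Proof.
move=> z01; have z01' : z \in `[0, 1] by apply: subset_itv_oo_cc.
have z0 : 0 < z by move: z01; rewrite in_itv /= => /andP[].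
have z1 : z < 1 by move: z01; rewrite in_itv /= => /andP[].
have cv : h^-1 *: (f (h *: (1 : R) + z) - f z) @[h --> 0^'] --> f' z.
  apply/cvgrPdist_le => e e0.
  have [delta d0 hd] := C1_on_unit_linear z01' e0.
  apply/nbhs_ballP; exists (Num.min delta (Num.min z (1 - z))) => /=.
    by rewrite !lt_min d0 z0 subr_gt0.
  move=> h /=; rewrite /ball /= sub0r normrN !lt_min => /andP[h1 /andP[h2 h3]] h0.
  have := hd (h + z); rewrite addrK => /(_ _ h1) H.
  have {H} : `|f (h + z) - f z - f' z * h| <= e * `|h|.
    apply: H; rewrite in_itv /=; move: h2 h3; rewrite !ltr_norml; lra.
  rewrite (_ : h *: (1 : R) = h); last by rewrite [LHS]mulr1.
  rewrite [_ *: _]/(_ * _) => H.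
  have -> : f' z - h^-1 * (f (h + z) - f z) = - h^-1 * (f (h + z) - f z - f' z * h).
    by field.
  by rewrite normrM normrN normfV mulrC ler_pdivrMr ?normr_gt0.
apply: DeriveDef; first by apply/cvg_ex; exists (f' z).
exact: cvg_lim cv.
Qed.

Lemma C1_on_unit_continuous (z : R) (F : set_system R) : Filter F ->
  z \in `[0, 1] -> F --> nbhs z -> F `[0, 1]%classic -> f @ F --> f z.
Proof.
move=> FF z01 Fz F01; apply/cvgrPdist_le => e e0.
have [delta d0 hd] := C1_on_unit_linear z01 ltr01.
pose c := 1 + `|f' z|.
have c0 : 0 < c by rewrite ltr_pwDl.
have Fb : F (ball z (Num.min delta (e / c))).
  by apply: Fz; apply: nbhsx_ballx; rewrite lt_min d0 divr_gt0.
near=> y.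
have y01 : y \in `[0, 1] by near: y; apply: filterS F01 => y; rewrite inE.
have : ball z (Num.min delta (e / c)) y by near: y.
rewrite /ball /= distrC lt_min => /andP[h1 h2].
have := hd y y01 h1; rewrite mul1r => h.
rewrite distrC -[f y - f z](subrK (f' z * (y - z))).
apply: (le_trans (ler_normD _ _)); rewrite normrM.
move: h2; rewrite ltr_pdivlMr // /c => h2.
by move: h h2; move: (`|_ - f' z * _|) (`|y - z|) => a b; lra.
Unshelve. all: by end_near. Qed.

(** Mean value theorem; continuity at the ends of [x, y] follows from the
    expansion even when these are 0 or 1. *)
Lemma slope_le_increment (l r B x y : R) :
  `[l, r] `<=` `[0, 1] -> (forall w, w \in `[l, r] -> B <= f' w) ->
  x \in `[l, r] -> y \in `[l, r] -> x <= y -> B * (y - x) <= f y - f x.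
Proof.
move=> lr fB xlr ylr; rewrite le_eqVlt => /predU1P[->|xy]; first by rewrite !subrr mulr0.
have x01 : x \in `[0, 1] by have := lr x; rewrite !inE; apply.
have y01 : y \in `[0, 1] by have := lr y; rewrite !inE; apply.
have xy01 z : z \in `]x, y[ -> z \in `]0, 1[.
  by move: x01 y01; rewrite !in_itv /=; lra.
have [||c cxy ->] := @MVT R f f' x y xy.
- by move=> z /xy01; exact: C1_on_unit_is_derive.
- apply/continuous_within_itvP => //; split.
  + move=> z /xy01/C1_on_unit_is_derive[dz _].
    exact/differentiable_continuous/derivable1_diffP.
  + apply: C1_on_unit_continuous => //.
      exact: cvg_within.
    near=> z; rewrite /= in_itv /=.
    have : x < z by [].
    have : z < y by near: z; exact: nbhs_right_lt.
    by move: x01 y01; rewrite !in_itv /=; lra.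
  + apply: C1_on_unit_continuous => //.
      exact: cvg_within.
    near=> z; rewrite /= in_itv /=.
    have : z < y by [].
    have : x < z by near: z; exact: nbhs_left_gt.
    by move: x01 y01; rewrite !in_itv /=; lra.
rewrite ler_wpM2r ?subr_ge0 ?(ltW xy) //; apply: fB.
by move: xlr ylr cxy; rewrite !in_itv /=; lra.
Unshelve. all: by end_near. Qed.

End UnitC1.

Lemma C1_on_unitN (R : realType) (f f' : R -> R) : C1_on_unit f f' ->
  C1_on_unit (fun x => - f x) (fun x => - f' x).
Proof.
move=> [h1 h2]; split.
  move=> x x01.
  have -> : (fun y => (- f y - - f x) / (y - x)) = (fun y => - ((f y - f x) / (y - x))).
    by apply/funext => y; rewrite -mulNr opprB opprK addrC.
  by apply: cvgN; exact: h1.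
by move=> x; apply: cvgN; exact: h2.
Qed.

(** * Local linear weights *)

Section Kernel.
Context {R : realType}.
Variable K : R -> R.
Hypothesis kernel_K : kernel_condition K.

Let K_ge0 v : 0 <= K v. Proof. by case: kernel_K. Qed.

Lemma kernel_support v : K v != 0 -> -1 <= v <= 1.
Proof.
move=> Kv; have [_ _ _ sK _] := kernel_K.
have : closure [set v | K v != 0] v by exact: subset_closure.
by rewrite sK /= in_itv.
Qed.

Lemma kernel_bounded : exists2 M : R, 0 < M & forall v, K v <= M.
Proof.
have [_ _ _ _ [C C0 lip]] := kernel_K.
exists (K 0 + C); first by rewrite ltr_wpDl.
move=> v; have [->|/kernel_support v1] := eqVneq (K v) 0.
  by rewrite addr_ge0 // ltW.
have v1' : `|v| <= 1 by rewrite ler_norml.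
have := lip v 0; rewrite subr0 ler_norml => /andP[_ h].
have := ler_wpM2l (ltW C0) v1'; lra.
Qed.

(** The point 1/2 lies in the closure of [K != 0], so [K] is positive somewhere near
    it, and by Lipschitz continuity bounded below on a neighbourhood.  That the
    neighbourhood avoids zero is what makes the design spread out below. *)
Lemma kernel_bump : exists (p r k : R), [/\ 0 < p, p < r, r <= 1, 0 < k &
  forall v, p <= v <= r -> k <= K v].
Proof.
have [_ _ _ sK [C C0 lip]] := kernel_K.
have : closure [set v | K v != 0] (2^-1 : R).
  by rewrite sK /= in_itv /=; lra.
move=> /(_ (ball (2^-1 : R) 4^-1)) [|v [/= Kv]].
  by apply: nbhsx_ballx; lra.
rewrite /ball /= ltr_norml => /andP[v1 v2].
have Kv0 : 0 < K v by rewrite lt_def Kv K_ge0.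
pose dl := Num.min 8^-1 (K v / (2 * C)).
have d0 : 0 < dl by rewrite lt_min divr_gt0 ?mulr_gt0 // andbT; lra.
have [d1 d2] : dl <= 8^-1 /\ dl <= K v / (2 * C).
  by split; rewrite /dl ge_min lexx ?orbT.
exists (v - dl), (v + dl), (K v / 2); split; [lra|lra|lra|by rewrite divr_gt0|].
move=> x /andP[x1 x2].
have xv : `|v - x| <= dl by rewrite ler_norml; lra.
have := lip v x; rewrite ler_norml => /andP[_ h].
have := ler_wpM2l (ltW C0) (le_trans xv d2).
have -> : C * (K v / (2 * C)) = K v / 2 by field; rewrite gt_eqF.
lra.
Qed.

End Kernel.

(** The integers in ]T a, T b] are those from [truncn (T a) + 1] to
    [truncn (T b)]. *)
Lemma count_grid (R : realType) (T : nat) (a b : R) : (0 < T)%N ->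
  0 <= a -> a <= b -> b <= 1 ->
  T%:R * (b - a) - 1 <= \sum_(1 <= t < T.+1) (a < t%:R / T%:R <= b)%R%:R :> R.
Proof.
move=> T0 a0 ab b1.
have TR : 0 < T%:R :> R by rewrite ltr0n.
have b0 : 0 <= b by lra.
pose i := Num.truncn (T%:R * a); pose j := Num.truncn (T%:R * b).
have /andP[i1 i2] := truncn_itv (mulr_ge0 (ltW TR) a0).
have /andP[j1 j2] := truncn_itv (mulr_ge0 (ltW TR) b0).
rewrite -/i -/j in i1 i2 j1 j2.
have ij : (i <= j)%N by apply: le_truncn; rewrite ler_pM2l.
have jT : (j <= T)%N.
  by rewrite -(ler_nat R) (le_trans j1) // ger_pMr.
rewrite (@big_cat_nat _ _ _ i.+1) //= ?ltnS ?(leq_trans ij) //.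
rewrite (@big_cat_nat _ _ _ j.+1 i.+1) //= ?ltnS //.
rewrite [X in _ <= _ + (X + _)](_ : _ = (j - i)%:R); last first.
  rewrite (eq_big_nat _ _ (F2 := fun=> 1)).
    by rewrite big_const_nat iter_addr addr0 subSS.
  move=> t /andP[it tj]; rewrite ltr_pdivlMr // ler_pdivrMr // [b * _]mulrC [a * _]mulrC.
  have h1 : T%:R * a < t%:R by rewrite (lt_le_trans i2) // ler_nat.
  have h2 : t%:R <= T%:R * b by rewrite (le_trans _ j1) // ler_nat -ltnS.
  by rewrite h1 h2.
have n1 : 0 <= \sum_(1 <= t < i.+1) (a < t%:R / T%:R <= b)%R%:R :> R by exact: sumr_ge0.
have n2 : 0 <= \sum_(j.+1 <= t < T.+1) (a < t%:R / T%:R <= b)%R%:R :> R by exact: sumr_ge0.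
rewrite natrB //; move: j2; rewrite -natr1; lra.
Qed.

(** Equality holds unless all weights vanish. *)
Lemma weight_sq_le1 (R : realType) (K : R -> R) T u h :
  \sum_(1 <= t < T.+1) weight K T t u h ^+ 2 <= 1.
Proof.
rewrite /weight; set D := \sum_(1 <= s < T.+1) Lambda_ K T s u h ^+ 2.
have D0 : 0 <= D by apply: sumr_ge0 => t _; exact: sqr_ge0.
under eq_bigr do rewrite exprMn exprVn sqr_sqrtr //.
rewrite -mulr_suml -/D; have [->|D1] := eqVneq D 0; first by rewrite mul0r.
by rewrite divff.
Qed.

Section Signal.
Context {R : realType}.
Variable K : R -> R.
Hypothesis kernel_K : kernel_condition K.

Let K_ge0 v : 0 <= K v. Proof. by case: kernel_K. Qed.

(** Whatever the centre [a], one of the two mirror bumps of the kernel lies on the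
    opposite side of zero, hence at distance at least [p] from [a]; it contains a
    number of design points proportional to [T h]. *)
Lemma kernel_spread : exists2 k1 : R, 0 < k1 & exists2 c0 : R, 0 < c0 &
  forall T u h, (0 < T)%N -> 0 < h -> 0 <= u - h -> u + h <= 1 -> c0 <= T%:R * h ->
  forall a, k1 * (T%:R * h) <=
    \sum_(1 <= t < T.+1) K (scaled T t u h) * (scaled T t u h - a) ^+ 2.
Proof.
have [p [r [k [p0 pr r1 k0 hk]]]] := kernel_bump kernel_K.
have rp0 : 0 < r - p by rewrite subr_gt0.
exists (k * p ^+ 2 * ((r - p) / 2)).
  by rewrite !mulr_gt0 // ?exprn_gt0 // divr_gt0.
exists (2 / (r - p)); first by rewrite divr_gt0.
move=> T u h T0 h0 uh uh1 Th a.
have TR : 0 < T%:R :> R by rewrite ltr0n.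
have half : T%:R * h * ((r - p) / 2) <= T%:R * (h * (r - p)) - 1.
  move: Th; rewrite ler_pdivrMr //; lra.
have kp : 0 <= k * p ^+ 2 by rewrite mulr_ge0 ?sqr_ge0 // ltW.
have rh : h * r <= h by rewrite ger_pMr.
have ph : 0 < h * p by rewrite mulr_gt0.
have prh : h * p < h * r by rewrite ltr_pM2l.
have term (lo hi : R) : (forall v, lo < v <= hi -> k * p ^+ 2 <= K v * (v - a) ^+ 2) ->
    0 <= u + h * lo -> lo <= hi -> u + h * hi <= 1 -> hi - lo = r - p ->
    k * p ^+ 2 * ((r - p) / 2) * (T%:R * h) <=
    \sum_(1 <= t < T.+1) K (scaled T t u h) * (scaled T t u h - a) ^+ 2.
  move=> hv ul lohi uhi hl.
  have lohi' : u + h * lo <= u + h * hi by rewrite lerD2l ler_pM2l.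
  have := count_grid T0 ul lohi' uhi.
  have -> : u + h * hi - (u + h * lo) = h * (r - p) by rewrite -hl; ring.
  move=> cnt.
  apply: (@le_trans _ _ (k * p ^+ 2 *
      \sum_(1 <= t < T.+1) (u + h * lo < t%:R / T%:R <= u + h * hi)%R%:R)).
    rewrite -mulrA ler_wpM2l //; lra.
  rewrite mulr_sumr; apply: ler_sum => t _.
  case: (boolP (u + h * lo < t%:R / T%:R <= u + h * hi)) => [/andP[t1 t2]|_] /=;
    last first.
    by rewrite mulr0 mulr_ge0 // sqr_ge0.
  rewrite mulr1; apply: hv; rewrite /scaled ltr_pdivlMr // ler_pdivrMr //.
  by apply/andP; split; lra.
have [a0|a0] := leP a 0.
  apply: (term p r); [|lra|lra|lra|lra].
  move=> v /andP[v1 v2]; apply: ler_pM; rewrite ?sqr_ge0 ?(ltW k0) //.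
    by apply: hk; rewrite (ltW v1).
  have p_va : p <= v - a by lra.
  by rewrite ler_sqr ?nnegrE //; [exact: ltW|apply: le_trans p_va; exact: ltW].
apply: (term (- r) (- p)); [|lra|lra|lra|lra].
move=> v /andP[v1 v2]; apply: ler_pM; rewrite ?sqr_ge0 ?(ltW k0) //.
  have [_ sy _ _ _] := kernel_K; rewrite -sy.
  by apply: hk; apply/andP; split; lra.
have p_va : p <= - (v - a) by lra.
by rewrite -[leRHS]sqrrN ler_sqr ?nnegrE //; [exact: ltW|apply: le_trans p_va; exact: ltW].
Qed.

(** With [Q = sum_t k_t (v_t - vs)^2], the numerator of the statistic is at least
    [S0 * B * h * Q], because each centred summand is nonnegative, and the norm of
    the weights is at most [S0 * sqrt (M * Q)].  The quotient is of order
    [B * h * sqrt Q], and [Q] is of order [T h] by [kernel_spread]. *)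
Lemma signal_lower_bound : exists2 kap : R, 0 < kap & exists2 c0 : R, 0 < c0 &
  forall T u h (f f' : R -> R) B, (0 < T)%N -> 0 < h ->
  `[u - h, u + h] `<=` `[0, 1] -> c0 <= T%:R * h -> C1_on_unit f f' -> 0 <= B ->
  (forall w, w \in `[u - h, u + h] -> B <= f' w) ->
  kap * (B * h * Num.sqrt (T%:R * h)) <= linear_stat K T (fun t => f (t%:R / T%:R)) u h.
Proof.
have [k1 k10 [c0 c00 spread]] := kernel_spread.
have [M M0 KM] := kernel_bounded kernel_K.
exists (Num.sqrt (k1 / M)); first by rewrite sqrtr_gt0 divr_gt0.
exists c0 => // T u h f f' B T0 h0 uh01 Th fC1 B0 fB.
have TR : 0 < T%:R :> R by rewrite ltr0n.
have uh0 : 0 <= u - h.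
  have := uh01 (u - h); rewrite /= !in_itv /= lexx; lra.
have uh1 : u + h <= 1.
  have := uh01 (u + h); rewrite /= !in_itv /= lexx; lra.
have {}spread := spread T u h T0 h0 uh0 uh1 Th.
pose n := T%:R * h; have n0 : 0 < n by rewrite mulr_gt0.
pose v t := scaled T t u h; pose k t := K (v t).
have k0 t : 0 <= k t by exact: K_ge0.
have vk t : k t != 0 -> `|v t| <= 1.
  by move=> kt; rewrite ler_norml; exact: (kernel_support kernel_K kt).
pose S0 := S_ K T 0 u h; pose S1 := S_ K T 1 u h.
have S0E : n * S0 = \sum_(1 <= t < T.+1) k t.
  rewrite /S0 /S_ mulrA divff ?gt_eqF // mul1r.
  by apply: eq_bigr => t _; rewrite expr0 mulr1.
have S1E : n * S1 = \sum_(1 <= t < T.+1) k t * v t.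
  rewrite /S1 /S_ mulrA divff ?gt_eqF // mul1r.
  by apply: eq_bigr => t _; rewrite expr1.
have S0gt : 0 < S0.
  rewrite -(pmulr_rgt0 _ n0) S0E; apply: lt_le_trans (_ : k1 * n <= _).
    by rewrite mulr_gt0.
  apply: (le_trans (spread 0)); apply: ler_sum => t _.
  rewrite subr0 -/(v t) -/(k t); have [->|/vk vt] := eqVneq (k t) 0; first by rewrite mul0r.
  by rewrite ler_piMr // -real_normK ?num_real // expr_le1.
have S1abs : `|S1| <= S0.
  rewrite -(ler_pM2l n0) -{1}(gtr0_norm n0) -normrM S0E S1E.
  apply: (le_trans (ler_norm_sum _ _ _)); apply: ler_sum => t _.
  rewrite normrM (ger0_norm (k0 t)).
  by have [->|/vk vt] := eqVneq (k t) 0; [rewrite mul0r|rewrite ler_piMr].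
(* the kernel-weighted mean of the rescaled design points *)
pose vs := S1 / S0.
have vs1 : `|vs| <= 1.
  by rewrite /vs normrM normfV (gtr0_norm S0gt) ler_pdivrMr // mul1r.
have LE t : Lambda_ K T t u h = S0 * (k t * (v t - vs)).
  rewrite /Lambda_ -/S0 -/S1 -/(v t) -/(k t) /vs; field; rewrite gt_eqF //.
have L0 : \sum_(1 <= t < T.+1) Lambda_ K T t u h = 0.
  under eq_bigr do rewrite LE.
  rewrite -mulr_sumr; under eq_bigr do rewrite mulrBr.
  rewrite big_split /= sumrN -mulr_suml -S0E -S1E /vs.
  by rewrite [X in _ * X](_ : _ = 0) ?mulr0 //; field; rewrite gt_eqF.
pose Q := \sum_(1 <= t < T.+1) k t * (v t - vs) ^+ 2.
have Qn : k1 * n <= Q by exact: spread.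
have Q0 : 0 < Q by apply: lt_le_trans Qn; rewrite mulr_gt0.
pose D := \sum_(1 <= t < T.+1) Lambda_ K T t u h ^+ 2.
have DM : D <= S0 ^+ 2 * (M * Q).
  rewrite /D /Q !mulr_sumr; apply: ler_sum => t _; rewrite LE exprMn.
  rewrite ler_wpM2l ?sqr_ge0 // exprMn mulrA ler_wpM2r ?sqr_ge0 // expr2.
  by rewrite ler_wpM2r // KM.
have D0 : 0 < D.
  rewrite lt_def sumr_ge0 ?andbT => [|t _]; last exact: sqr_ge0.
  apply/eqP => Dz; move: Q0; rewrite /Q big_nat big1 ?ltxx // => t tT.
  have /eqP : Lambda_ K T t u h ^+ 2 == 0.
    move/eqP: Dz; rewrite /D big_nat psumr_eq0; last by move=> *; exact: sqr_ge0.
    by move=> /allP/(_ t); rewrite mem_index_iota tT => /(_ isT).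
  rewrite LE => /eqP; rewrite sqrf_eq0 mulf_eq0 gt_eqF //= mulf_eq0.
  by case/orP => /eqP ->; rewrite ?mul0r // expr0n /= mulr0.
pose xs := u + h * vs.
have in_uh z : `|z| <= 1 -> u + h * z \in `[u - h, u + h].
  rewrite ler_norml in_itv /= => /andP[z1 z2].
  have := ler_wpM2l (ltW h0) z1; have := ler_wpM2l (ltW h0) z2.
  by rewrite mulr1 mulrN1; lra.
have NL : S0 * B * h * Q <= \sum_(1 <= t < T.+1) Lambda_ K T t u h * f (t%:R / T%:R).
  have -> : \sum_(1 <= t < T.+1) Lambda_ K T t u h * f (t%:R / T%:R) =
      \sum_(1 <= t < T.+1) Lambda_ K T t u h * (f (t%:R / T%:R) - f xs).
    under [RHS]eq_bigr do rewrite mulrBr.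
    by rewrite big_split /= sumrN -mulr_suml L0 mul0r subr0.
  rewrite /Q mulr_sumr; apply: ler_sum => t _; rewrite LE.
  have -> : t%:R / T%:R = u + h * v t.
    by rewrite /v /scaled; field; rewrite !gt_eqF.
  have [->|kt] := eqVneq (k t) 0; first by rewrite !mul0r !mulr0 mul0r.
  have vt := in_uh _ (vk _ kt); have vsin := in_uh _ vs1.
  have key : B * h * (v t - vs) ^+ 2 <= (v t - vs) * (f (u + h * v t) - f xs).
    have [vv|vv] := leP (v t) vs.
      have hh : u + h * v t <= xs by rewrite lerD2l ler_pM2l.
      have := slope_le_increment fC1 uh01 fB vt vsin hh.
      rewrite /xs => H; have vv0 : 0 <= vs - v t by rewrite subr_ge0.
      have := ler_wpM2l vv0 H; lra.
    have hh : xs <= u + h * v t by rewrite lerD2l ler_pM2l // ltW.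
    have := slope_le_increment fC1 uh01 fB vsin vt hh.
    rewrite /xs => H; have vv0 : 0 <= v t - vs by rewrite subr_ge0 ltW.
    have := ler_wpM2l vv0 H; lra.
  have := ler_wpM2l (mulr_ge0 (ltW S0gt) (k0 t)) key; lra.
have -> : linear_stat K T (fun t => f (t%:R / T%:R)) u h =
    (\sum_(1 <= t < T.+1) Lambda_ K T t u h * f (t%:R / T%:R)) / Num.sqrt D.
  by rewrite /linear_stat mulr_suml; apply: eq_bigr => t _; rewrite /weight mulrAC.
rewrite ler_pdivlMr ?sqrtr_gt0 //; apply: le_trans NL.
have sD : Num.sqrt D <= S0 * Num.sqrt (M * Q).
  rewrite -[X in X * _](gtr0_norm S0gt) -sqrtr_sqr -sqrtrM ?sqr_ge0 //.
  exact: ler_wsqrtr.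
have sk : Num.sqrt (k1 / M) * Num.sqrt n * Num.sqrt (M * Q) <= Q.
  rewrite -!sqrtrM ?mulr_ge0 ?invr_ge0 ?(ltW TR) ?(ltW h0) ?(ltW k10) ?(ltW M0) ?(ltW n0) //.
  have -> : k1 / M * n * (M * Q) = k1 * n * Q by field; rewrite gt_eqF.
  rewrite -[leRHS](gtr0_norm Q0) -sqrtr_sqr; apply: ler_wsqrtr.
  by rewrite expr2 ler_pM2r.
have Bh : 0 <= B * h by rewrite mulr_ge0 // ltW.
have h1 : 0 <= Num.sqrt (k1 / M) * (B * h * Num.sqrt n).
  by rewrite mulr_ge0 ?sqrtr_ge0 // mulr_ge0 // sqrtr_ge0.
apply: (le_trans (ler_wpM2l h1 sD)).
have := ler_wpM2l (mulr_ge0 (ltW S0gt) Bh) sk; lra.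
Qed.

End Signal.

(** * Gaussian tails *)

Section Density.
Context {R : realType} (nu : {measure set R -> \bar R}) (p : R -> R).
Local Notation mu := (@lebesgue_measure R).
Hypotheses (mp : measurable_fun setT p) (p0 : forall x, 0 <= p x)
  (nuE : forall A, measurable A -> (nu A = \int[mu]_(x in A) (p x)%:E)%E).

Import HBNNSimple.

Let integral_density_nnsfun (f : {nnsfun R >-> R}) :
  (\int[nu]_x (f x)%:E = \int[mu]_x (f x * p x)%:E)%E.
Proof.
have mr r : measurable (f @^-1` [set r]) by exact: measurable_funPTI.
under [LHS]eq_integral do rewrite fimfunE -fsumEFin//.
rewrite [LHS]ge0_integral_fsum//; last 2 first.
- by move=> r; exact/measurable_EFinP/measurableT_comp.
- by move=> n x _; rewrite EFinM nnfun_muleindic_ge0.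
under [RHS]eq_integral.
  move=> x xD; rewrite EFinM muleC fimfunE -fsumEFin// ge0_mule_fsumr; last first.
    by move=> r; rewrite EFinM nnfun_muleindic_ge0.
  over.
rewrite [RHS]ge0_integral_fsum//; last 2 first.
- move=> r; apply/measurable_EFinP; apply: measurable_funM; first exact: mp.
  apply: measurable_funM => //.
  by have := @measurable_indic _ R R setT _ (mr r).
- move=> n x _; apply: mule_ge0; first by rewrite lee_fin.
  by rewrite EFinM nnfun_muleindic_ge0.
apply: eq_fsbigr => r _.
have [r0|r0] := ltP r 0.
  rewrite (_ : f @^-1` [set r] = set0).
    rewrite !integral0_eq // => x _; rewrite indic0 mulr0 //.
    by rewrite mule0.
  apply/seteqP; split => // x /= fr.
  have : 0 <= f x by exact: fun_ge0.
  by rewrite fr leNgt r0.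
under eq_integral do rewrite EFinM.
rewrite ge0_integralZl //; last exact/measurable_EFinP.
rewrite integral_indic // setIT nuE //.
rewrite -ge0_integralZl //; last 2 first.
- exact/measurable_funTS/measurable_EFinP.
- by move=> x _; rewrite lee_fin.
rewrite [LHS]integral_mkcond.
apply: eq_integral => x _; rewrite patchE indicE.
by case: ifP => _; rewrite ?mulr1 ?mulr0 ?mule0 // muleC.
exact: mr.
Qed.

(** Holds for indicators by [nuE], hence for simple functions, hence for monotone
    limits of these. *)
Lemma ge0_integral_density (f : R -> R) : measurable_fun setT f -> (forall x, 0 <= f x) ->
  (\int[nu]_x (f x)%:E = \int[mu]_x (f x * p x)%:E)%E.
Proof.
move=> mf f0.
have mf' : measurable_fun [set: R] (EFin \o f) by exact/measurable_EFinP.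
pose f_ := nnsfun_approx measurableT mf'.
have fE x : (f x)%:E = limn (fun n => (f_ n x)%:E).
  apply/esym/cvg_lim => //.
  by apply: (cvg_nnsfun_approx measurableT mf') => // y _; rewrite lee_fin.
transitivity (\int[nu]_x limn (fun n => (f_ n x)%:E))%E.
  by apply: eq_integral => x _.
have mfn n : measurable_fun [set: R] (EFin \o f_ n) by exact/measurable_EFinP.
have ndf x : {homo (fun n => (f_ n x)%:E) : a b / (a <= b)%N >-> (a <= b)%E}.
  by move=> a b ab; rewrite lee_fin; exact/lefP/nd_nnsfun_approx.
rewrite monotone_convergence //; last first.
  by move=> n x _; rewrite lee_fin.
transitivity (\int[mu]_x limn (fun n => (f_ n x * p x)%:E))%E; last first.
  apply: eq_integral => x _; rewrite EFinM fE muleC -limeMl //.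
    by apply: congr_lim; apply/funext => n; rewrite -EFinM mulrC.
  by apply: ereal_nondecreasing_is_cvgn => a b ab; exact: ndf.
rewrite monotone_convergence //; last 3 first.
- move=> n; apply/measurable_EFinP.
  have h : measurable_fun [set: R] (fun x => f_ n x * p x) by exact: measurable_funM.
  exact: h.
- by move=> n x _; rewrite lee_fin mulr_ge0.
- by move=> x _ a b ab; rewrite lee_fin ler_wpM2r //; have := ndf x a b ab.
congr (limn _); apply/funext => n.
exact: integral_density_nnsfun.
Qed.

End Density.
Arguments ge0_integral_density {R nu p}.

Section Gaussian.
Context {d : measure_display} {T : measurableType d} {R : realType}
  {P : probability T R}.

(** Completing the square: tilting the standard normal density by [expR (s * x)]
    gives, up to the factor, the normal density with mean [s]. *)
Lemma normal_mgf (Z : {RV P >-> R}) (s : R) : standard_normal Z ->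
  (\int[P]_w (expR (s * Z w))%:E = (expR (s ^+ 2 / 2))%:E)%E.
Proof.
move=> nZ.
have mexp : measurable_fun [set: R] (fun x : R => expR (s * x)).
  by apply: measurableT_comp => //; exact: measurable_funM.
have e0 x : 0 <= expR (s * x) by exact: expR_ge0.
transitivity (\int[distribution P Z]_x (expR (s * x))%:E)%E.
  by rewrite ge0_integral_distribution //; exact/measurable_EFinP.
rewrite (ge0_integral_density (measurable_normal_pdf 0 1) (normal_pdf_ge0 0 1)) //.
have -> : (\int[lebesgue_measure]_x (expR (s * x) * normal_pdf 0 1 x)%:E =
    \int[lebesgue_measure]_x ((expR (s ^+ 2 / 2))%:E * (normal_pdf s 1 x)%:E))%E.
  apply: eq_integral => x _; rewrite -EFinM; congr EFin.
  rewrite !normal_pdfE ?oner_eq0 // /normal_fun mulrCA [RHS]mulrCA; congr (_ * _).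
  by rewrite -!expRD; congr expR; field.
rewrite ge0_integralZl //; first last.
- by move=> x _; rewrite lee_fin; exact: normal_pdf_ge0.
- by apply/measurable_EFinP; exact: measurable_normal_pdf.
by rewrite integral_normal_pdf mule1.
Qed.

Variable Z : nat -> {RV P >-> R}.
Hypotheses (indep_Z : mutually_independent Z) (normal_Z : forall t, standard_normal (Z t)).

Local Notation path J := (g_sigma_algebraType (@cylinders R J)).

Lemma normal_combination_mgf (a : nat -> R) (n : nat) :
  (\int[P]_w (expR (\sum_(i < n) a i * Z i w))%:E =
   (expR (\sum_(i < n) a i ^+ 2 / 2))%:E)%E.
Proof.
elim: n => [|n ih].
  under eq_integral do rewrite big_ord0.
  rewrite big_ord0 expR0 integral_cst //.
  by have /= -> := probability_setT P; rewrite mule1.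
pose H (x : path 'I_n) : R := expR (\sum_(i < n) a i * x i).
pose H' (x : path unit) : R := expR (a n * x tt).
have mH : measurable_fun setT H.
  apply: measurableT_comp => //; apply: measurable_sum => i.
  by apply: measurable_funM => //; exact: measurable_coordinate.
have mH' : measurable_fun setT H'.
  apply: measurableT_comp => //.
  by apply: measurable_funM => //; exact: measurable_coordinate.
pose p (i : 'I_n) : nat := i; pose p' (i : unit) := n.
have mU : measurable_fun setT (fun w => H (subpath Z p w)).
  by apply: measurableT_comp => //; exact: measurable_subpath.
have mV : measurable_fun setT (fun w => H' (subpath Z p' w)).
  by apply: measurableT_comp => //; exact: measurable_subpath.
have := @indep_integralM _ _ _ P _ _ mU mV (fun=> expR_ge0 _) (fun=> expR_ge0 _).
rewrite big_ord_recr /= expRD EFinM -ih -(normal_mgf (a n) (normal_Z n)).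
move=> <-.
  by apply: eq_integral => w _; rewrite big_ord_recr /= expRD.
move=> A B mA mB.
apply: (indep_subpath indep_Z (p := p) (p' := p') _ _ _ (C := H @^-1` A) (C' := H' @^-1` B)).
- exact: ord_inj.
- by case=> [] [].
- by move=> i j; rewrite /p /p' => E; have := ltn_ord i; rewrite E ltnn.
- by rewrite -[X in measurable X]setTI; exact: mH.
- by rewrite -[X in measurable X]setTI; exact: mH'.
Qed.

(** Chernoff with the optimal exponent [x]. *)
Lemma normal_combination_tail (a : nat -> R) (n : nat) (x : R) :
  \sum_(i < n) a i ^+ 2 <= 1 -> 0 < x ->
  (P [set w | (x < `|\sum_(i < n) a i * Z i w|)%R] <= (2 * expR (- (x ^+ 2 / 2)))%:E)%E.
Proof.
move=> a1 x0.
have mS (b : nat -> R) : measurable_fun setT (fun w => \sum_(i < n) b i * Z i w).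
  by apply: measurable_sum => i; apply: measurable_funM.
have half (b : nat -> R) : \sum_(i < n) b i ^+ 2 <= 1 ->
    (P [set w | (x <= \sum_(i < n) b i * Z i w)%R] <= (expR (- (x ^+ 2 / 2)))%:E)%E.
  move=> b1.
  pose S : {RV P >-> R} := HB.pack (fun w => \sum_(i < n) b i * Z i w)
    (isMeasurableFun.Build _ _ _ _ _ (mS b)).
  have := chernoff S x x0; move=> /le_trans; apply.
  rewrite /mmt_gen_fun unlock.
  rewrite (_ : (\int[P]_w _)%E = \int[P]_w (expR (\sum_(i < n) (x * b i) * Z i w))%:E)%E; last first.
    apply: eq_integral => w _ /=; congr (expR _)%:E.
    by rewrite mulr_suml; apply: eq_bigr => i _; ring.
  rewrite (normal_combination_mgf (fun i => x * b i)) -EFinM lee_fin -expRD ler_expR.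
  rewrite (_ : \sum_(i < n) _ = x ^+ 2 / 2 * \sum_(i < n) b i ^+ 2); last first.
    by rewrite mulr_sumr; apply: eq_bigr => i _; field.
  have := ler_wpM2l (sqr_ge0 x) b1; lra.
have mhalf (b : nat -> R) : measurable [set w | x <= \sum_(i < n) b i * Z i w].
  have := mS b measurableT `[x, +oo[%classic (measurable_itv _).
  rewrite setTI; congr (measurable _); apply/seteqP; split => w /=;
  by rewrite in_itv /= andbT.
have mabs := measurable_abs_gt x (mS a).
have mh := mhalf a; have mhN := mhalf (fun i => - a i).
apply: (@le_trans _ _ (P ([set w | (x <= \sum_(i < n) a i * Z i w)%R] `|`
    [set w | (x <= \sum_(i < n) - a i * Z i w)%R]))).
  apply: le_measure; rewrite ?inE //; first exact: measurableU.
  move=> w /=; under [X in _ \/ (_ <= X)]eq_bigr do rewrite mulNr.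
  rewrite sumrN; case: (ger0P (\sum_(i < n) a i * Z i w)) => _ /ltW; by [left|right].
apply: (le_trans (measureU2 _ _ _)) => //.
rewrite mulr2n mulrDl mul1r EFinD leeD //; first exact: half.
by apply: (half (fun i => - a i)); under eq_bigr do rewrite sqrrN.
Qed.

End Gaussian.

(** If the set defining the quantile has no infimum, then its [inf] is 0 by
    convention, whence the sign condition on [x]. *)
Lemma quantile_le d (T : measurableType d) (R : realType) (P : probability T R)
    (X : T -> R) (p x : R) : 0 <= x ->
  (p%:E <= P [set w | (X w <= x)%R])%E -> quantile P X p <= x.
Proof.
move=> x0 px; rewrite /quantile; set E := [set _ | _].
have [Einf|Einf] := pselect (has_inf E); last by rewrite inf_out.
by apply: ge_inf => //; case: Einf.
Qed.

Section MultiscaleStat.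
Context {R : realType}.
Variables (K : R -> R) (T : nat) (G : {fset R * R}) (s : R) (y : nat -> R).

Let val (p : R * R) := `|linear_stat K T y p.1 p.2 / s| - lambda_ p.2.

(** The supremum is over a finite set, which is bounded by the sum of the absolute
    values. *)
Lemma multiscale_stat_ge (u h : R) : (u, h) \in G ->
  `|linear_stat K T y u h / s| - lambda_ h <= multiscale_stat K T G s y.
Proof.
move=> uhG; apply: ub_le_sup; last by exists (u, h).
exists (\sum_(p <- G) `|val p|) => _ [p pG <-].
rewrite (big_fsetD1 p) //= (le_trans (ler_norm _)) // lerDl.
exact: sumr_ge0.
Qed.

Lemma multiscale_stat_le (x : R) : G != fset0 ->
  (multiscale_stat K T G s y <= x) <->
  (forall p, p \in G -> `|linear_stat K T y p.1 p.2 / s| - lambda_ p.2 <= x).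
Proof.
move=> G0; split => [h [u h'] pG|h].
  by apply: le_trans h; exact: multiscale_stat_ge.
apply: ge_sup; last by move=> _ [p pG <-]; exact: h.
by have [E|[p pG]] := fset_0Vmem G; [move: G0; rewrite E eqxx|exists (val p), p].
Qed.

End MultiscaleStat.

Lemma measurable_multiscale_le d (T : measurableType d) (R : realType)
    (K : R -> R) n (G : {fset R * R}) (s : T -> R) (y : nat -> T -> R) (x : R) :
  G != fset0 -> measurable_fun setT s -> (forall t, measurable_fun setT (y t)) ->
  measurable [set w | multiscale_stat K n G (s w) (fun t => y t w) <= x].
Proof.
move=> G0 ms my.
have -> : [set w | multiscale_stat K n G (s w) (fun t => y t w) <= x] =
  \bigcap_(p in [set` G]) [set w |
    `|linear_stat K n (fun t => y t w) p.1 p.2 / s w| - lambda_ p.2 <= x].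
  apply/seteqP; split=> w /=; first by move=> /multiscale_stat_le h p /h; exact.
  by move=> h; apply/multiscale_stat_le.
apply: fin_bigcap_measurable => // p _.
(* division is not continuous at 0, so the quotient is cleared *)
set v := x + lambda_ p.2; pose L w := linear_stat K n (fun t => y t w) p.1 p.2.
have mL : measurable_fun setT L.
  by apply: measurable_sum => t; apply: measurable_funM; [exact: measurable_cst|exact: my].
have -> : [set w | `|L w / s w| - lambda_ p.2 <= x] =
    ([set w | s w = 0 /\ 0 <= v]) `|`
    ((~` [set w | s w = 0]) `&` [set w | `|L w| - v * `|s w| <= 0]).
  apply/seteqP; split=> w; rewrite /= (lerBlDr _ (lambda_ p.2)) -/v.
    have [->|s0] := eqVneq (s w) 0; first by rewrite invr0 mulr0 normr0; left.
    rewrite normrM normfV ler_pdivrMr ?normr_gt0 // => h; right; split.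
      exact/eqP.
    by rewrite subr_le0.
  move=> [[-> v0]|[/eqP s0 h]]; first by rewrite invr0 mulr0 normr0.
  by rewrite normrM normfV ler_pdivrMr ?normr_gt0 // -subr_le0.
have ms0 : measurable [set w | s w = 0].
  have := ms measurableT [set 0] (measurable_set1 _).
  by rewrite setTI.
apply: measurableU.
  have [v0|v0] := boolP (0 <= v).
    rewrite (_ : [set w | _] = [set w | s w = 0]) //.
    by apply/seteqP; split=> w //= [].
  rewrite (_ : [set w | _] = set0) //.
  by apply/seteqP; split=> w //= [].
apply: measurableI; first exact: measurableC.
have mf : measurable_fun setT (fun w => `|L w| - v * `|s w|).
  apply: measurable_funB; first exact: measurableT_comp.
  by apply: measurable_funM => //; exact: measurableT_comp.
have := mf measurableT `]-oo, 0]%classic (measurable_itv _).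
by rewrite setTI; congr (measurable _); apply/seteqP; split => w /=; rewrite in_itv.
Qed.

(** * The quantile of the Gaussian statistic *)

Lemma prob_cvg0 d (T : measurableType d) (R : realType) (P : probability T R)
    (E : nat -> set T) :
  P (E n) @[n --> \oo] --> 0%E <->
  (forall e : R, 0 < e -> \forall n \near \oo, (P (E n) <= e%:E)%E).
Proof.
split=> [/fine_cvgP[Ef /cvgrPdist_le E0] e e0|E0].
  have := E0 e e0 => E0e; near=> n.
  have nf : P (E n) \is a fin_num by near: n.
  have : `|0 - (fine \o P \o E) n| <= e by near: n.
  by rewrite sub0r normrN /= => h; rewrite -(fineK nf) lee_fin (le_trans (ler_norm _)).
have Ef e n : (P (E n) <= e%:E)%E -> P (E n) \is a fin_num.
  by move=> h; rewrite ge0_fin_numE // (le_lt_trans h) // ltry.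
apply/fine_cvgP; split.
  by near=> n; apply: (Ef 1); near: n; exact: E0.
apply/cvgrPdist_le => e e0; near=> n.
have h : (P (E n) <= e%:E)%E by near: n; exact: E0.
rewrite sub0r normrN /= ger0_norm ?fine_ge0 //.
by rewrite -lee_fin fineK // (Ef e).
Unshelve. all: by end_near. Qed.

Lemma prob_union_le d (T : measurableType d) (R : realType) (P : probability T R)
    (I : eqType) (s : seq I) (A : I -> set T) (c : R) :
  (forall i, i \in s -> measurable (A i) /\ (P (A i) <= c%:E)%E) ->
  measurable (\big[setU/set0]_(i <- s) A i) /\
  (P (\big[setU/set0]_(i <- s) A i) <= ((size s)%:R * c)%:E)%E.
Proof.
elim: s => [_|i s ih h]; first by rewrite big_nil measure0 mul0r.
have [mA PA] := h i (mem_head _ _).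
have [|ms Ps] := ih; first by move=> j js; apply: h; rewrite inE js orbT.
rewrite big_cons; split; first exact: measurableU.
by rewrite (le_trans (measureU2 _ mA ms)) //= -natr1 mulrDl mul1r addrC EFinD leeD.
Qed.

Lemma ln_nat_ge (R : realType) (M : R) : \forall T \near \oo, M <= ln T%:R :> R.
Proof.
near=> T; have h : expR M <= T%:R by near: T; exact: nbhs_infty_ger.
by rewrite -[M]expRK ler_ln ?posrE ?expR_gt0 // (lt_le_trans _ h) // expR_gt0.
Unshelve. all: by end_near. Qed.

Lemma linear_statD (R : realType) (K : R -> R) T (y z : nat -> R) u h :
  linear_stat K T (fun t => y t + z t) u h =
  linear_stat K T y u h + linear_stat K T z u h.
Proof. by rewrite -big_split /=; apply: eq_bigr => t _; rewrite mulrDr. Qed.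

Lemma linear_statN (R : realType) (K : R -> R) T (y : nat -> R) u h :
  linear_stat K T (fun t => - y t) u h = - linear_stat K T y u h.
Proof. by rewrite -sumrN; apply: eq_bigr => t _; rewrite mulrN. Qed.

Section Quantile.
Context {d : measure_display} {Omega : measurableType d} {R : realType}
  {P : probability Omega R}.
Variables (Z : nat -> {RV P >-> R}) (K : R -> R) (G : nat -> {fset R * R})
  (theta alpha : R).
Hypotheses (indep_Z : mutually_independent Z) (normal_Z : forall t, standard_normal (Z t))
  (grid_nonempty : forall T, (0 < T)%N -> G T != fset0)
  (theta_gt0 : 0 < theta) (alpha_gt0 : 0 < alpha)
  (card_grid : (fun T : nat => (#|` G T|%:R : R^o)) =O_\oo
               (fun T : nat => (T%:R `^ theta : R^o))).

(** The sum starts at 1; the weight at time 0 is set to zero to index it by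
    ordinals. *)
Lemma linear_stat_tail T u h (x : R) : 0 < x ->
  (P [set w | (x < `|linear_stat K T (fun t => Z t w) u h|)%R] <=
   (2 * expR (- (x ^+ 2 / 2)))%:E)%E.
Proof.
move=> x0; pose a (t : nat) := if t == 0%N then 0 else weight K T t u h.
have aE (F : nat -> R) : \sum_(i < T.+1) a i * F i = \sum_(1 <= t < T.+1) weight K T t u h * F t.
  rewrite -(big_mkord predT (fun i => a i * F i)) big_ltn // /a eqxx mul0r add0r.
  by apply: eq_big_nat => -[|t].
have a1 : \sum_(i < T.+1) a i ^+ 2 <= 1.
  have -> : \sum_(i < T.+1) a i ^+ 2 = \sum_(i < T.+1) a i * a i.
    by apply: eq_bigr => i _; rewrite expr2.
  rewrite (aE a); have := weight_sq_le1 K T u h; congr (_ <= _).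
  apply: eq_big_nat => -[|t] // _.
have := normal_combination_tail indep_Z normal_Z a1 x0.
by under eq_fun => w do rewrite (aE (fun t => Z t w)).
Qed.

(** At [x = C * sqrt (log T)] the Gaussian tail is [T^(-theta-1)], so that the
    union bound over [O(T^theta)] grid points tends to zero.  The corrections
    [lambda h] only help. *)
Lemma quantile_Phi_bound : exists2 C : R, 0 < C & \forall T \near \oo,
  quantile P (Phi K G Z T) (1 - alpha) <= C * Num.sqrt (ln T%:R).
Proof.
have t1 : 0 < 2 * (theta + 1) by rewrite mulr_gt0 // addr_gt0.
pose C := Num.sqrt (2 * (theta + 1)); have C0 : 0 < C by rewrite sqrtr_gt0.
exists C => //.
have [k [k0 hk]] := (eqO_exP _ _ _).1 card_grid.
near=> T.
have T0 : (0 < T)%N by near: T; exact: nbhs_infty_gt.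
have TR : 0 < T%:R :> R by rewrite ltr0n.
have T00 : T%:R != 0 :> R by rewrite gt_eqF.
have lT : 1 <= ln T%:R :> R by near: T; exact: ln_nat_ge.
have cardT : #|` G T|%:R <= k * T%:R `^ theta.
  have : `|#|` G T|%:R : R^o| <= k * `|T%:R `^ theta : R^o| by near: T.
  by rewrite ger0_norm // ger0_norm // powR_ge0.
have Tk : 2 * k / alpha <= T%:R by near: T; exact: nbhs_infty_ger.
set x := C * Num.sqrt (ln T%:R).
have x0 : 0 < x by rewrite mulr_gt0 // sqrtr_gt0 (lt_le_trans ltr01).
have expx : expR (- (x ^+ 2 / 2)) = T%:R `^ (- theta) / T%:R.
  rewrite /x exprMn /C !sqr_sqrtr ?(ltW t1) ?(le_trans ler01) //.
  rewrite -powR_inv1 ?(ltW TR) // -powRD ?T00 ?implybT //.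
  by rewrite /powR gt_eqF //; congr expR; field.
apply: quantile_le; first exact: ltW.
have mPhi : measurable [set w | Phi K G Z T w <= x].
  by apply: measurable_multiscale_le => //; exact: grid_nonempty.
pose A (p : R * R) := [set w | x < `|linear_stat K T (fun t => Z t w) p.1 p.2|].
have mA p : measurable (A p).
  by apply: measurable_abs_gt; apply: measurable_sum => t; apply: measurable_funM.
have [mU PU] := @prob_union_le _ _ _ P _ (G T) A _
  (fun p _ => conj (mA p) (linear_stat_tail T p.1 p.2 x0)).
have sub : ~` [set w | Phi K G Z T w <= x] `<=` \big[setU/set0]_(p <- G T) A p.
  move=> w /= nle; rewrite -bigcup_seq.
  apply: contrapT => nU; apply: nle.
  apply/(multiscale_stat_le K T 1 _ _ (grid_nonempty T0)) => p pG.
  rewrite divr1 lerBlDr; apply: (@le_trans _ _ x); last by rewrite lerDl sqrtr_ge0.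
  by rewrite leNgt; apply/negP => h; apply: nU; exists p.
have PC : (P (~` [set w | (Phi K G Z T w <= x)%R]) <= alpha%:E)%E.
  apply: (le_trans (le_measure P _ _ sub)); rewrite ?inE //.
    exact: measurableC.
  apply: (le_trans PU); rewrite lee_fin expx.
  apply: (@le_trans _ _ (k * T%:R `^ theta * (2 * (T%:R `^ (- theta) / T%:R)))).
    rewrite ler_wpM2r // mulr_ge0 // mulr_ge0 ?powR_ge0 // invr_ge0 ltW //.
  rewrite (_ : _ * _ = 2 * k / T%:R * (T%:R `^ theta * T%:R `^ (- theta))); last by ring.
  rewrite -powRD ?T00 ?implybT // subrr powRr0 mulr1.
  by rewrite ler_pdivrMr // [leRHS]mulrC -ler_pdivrMr.
rewrite -[X in (_ <= P X)%E]setCK probability_setC; last exact: measurableC.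
by rewrite EFinB leeB.
Unshelve. all: by end_near. Qed.

End Quantile.

(** * The power of the multiscale test *)

(** As [T^(2/q) >= 1], the lower bound on the bandwidths exceeds [log T / T]. *)
Lemma effective_sample_size (R : realType) (hmin : nat -> R) (q : R) : 0 < q ->
  hmin T / (T%:R `^ (- (1 - 2 / q)) * ln T%:R) @[T --> \oo] --> +oo ->
  \forall T \near \oo, ln T%:R <= T%:R * hmin T.
Proof.
move=> q0 /cvgryPge/(_ 1) h; near=> T.
have T0 : (0 < T)%N by near: T; exact: nbhs_infty_gt.
have TR : 0 < T%:R :> R by rewrite ltr0n.
have T1 : 1 <= T%:R :> R by rewrite ler1n.
have lT : 1 <= ln T%:R :> R by near: T; exact: ln_nat_ge.
have l0 : 0 < ln T%:R :> R by exact: lt_le_trans lT.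
have : 1 <= hmin T / (T%:R `^ (- (1 - 2 / q)) * ln T%:R) by near: T.
rewrite ler_pdivlMr ?mulr_gt0 ?powR_gt0 // mul1r => hm.
have pw : T%:R^-1 <= T%:R `^ (- (1 - 2 / q)).
  rewrite -(powR_inv1 (ltW TR)); apply: (ler_powR T1).
  have : 0 < 2 / q by rewrite divr_gt0.
  by move: (2 / q) => z; lra.
apply: (@le_trans _ _ (T%:R * (T%:R^-1 * ln T%:R))).
  by rewrite mulrA divff ?gt_eqF // mul1r.
rewrite ler_wpM2l ?ler0n // (le_trans _ hm) // ler_wpM2r // ltW.
Unshelve. all: by end_near. Qed.

Theorem proposition3p2 (R : realType)
  (d : measure_display) (Omega : measurableType d) (P : probability Omega R)
  (d' : measure_display) (Omega' : measurableType d') (P' : probability Omega' R)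
  (eps eta eta' : int -> {RV P >-> R}) (filt : (int -> R) -> R)
  (q A theta alpha : R) (K : R -> R) (G : nat -> {fset R * R})
  (hmin hmax rho c : nat -> R) (m m' : nat -> R -> R)
  (sigma2_hat : forall T : nat, T.-tuple R -> R) (Z : nat -> {RV P' >-> R})
  (stat_eps : strictly_stationary eps)
  (mean_eps : forall t, ('E_P[eps t] = 0)%E)
  (* C1 *)
  (iid_eta : iid eta)
  (meas_filt : measurable_filter filt)
  (eps_filt : forall t w, eps t w = filtered filt eta t w)
  (* C2 *)
  (q_gt4 : 4 < q)
  (mom_eps : forall t, ('N[P]_(q%:E) [EFin \o eps t] < +oo)%E)
  (* C3 *)
  (copy_eta : iid_copy eta eta')
  (A_gt : 2 / 3 * (1 / q + 1 + tau q) < A)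
  (dep_eps : exists C : R, \forall t \near \oo,
     (dependence_tail q filt eta eta' t <=
      (C * (t%:R `^ (- tau q) * ln t%:R `^ (- A)))%:E)%E)
  (* C4 *)
  (kernel_K : kernel_condition K)
  (grid_nonempty : forall T, (0 < T)%N -> G T != fset0)
  (grid_sub : forall T p, (0 < T)%N -> p \in G T ->
     (exists2 t : nat, (1 <= t <= T)%N & p.1 = t%:R / T%:R) /\
     p.2 \in `[hmin T, hmax T])
  (* C5 *)
  (theta_gt0 : 0 < theta)
  (card_grid : (fun T : nat => (#|` G T|%:R : R^o)) =O_\oo
               (fun T : nat => (T%:R `^ theta : R^o)))
  (* C6 *)
  (hmin_rate :
     hmin T / (T%:R `^ (- (1 - 2 / q)) * ln T%:R) @[T --> \oo] --> +oo)
  (hmax_lt : forall T, (0 < T)%N -> hmax T < 1 / 2)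
  (m_C1 : forall T, (0 < T)%N -> C1_on_unit (m T) (m' T))
  (lrv_gt0 : 0 < long_run_variance eps)
  (meas_hat : forall T, (0 < T)%N -> measurable_fun setT (sigma2_hat T))
  (rho_gt0 : forall T, (0 < T)%N -> 0 < rho T)
  (rho_rate : (rho : nat -> R^o) =o_\oo (fun T : nat => ((ln T%:R)^-1 : R^o)))
  (hat_consistent : littleo_in_probability P
     (fun T w => estimate sigma2_hat m eps T w - long_run_variance eps) rho)
  (alpha_gt0 : 0 < alpha) (alpha_lt1 : alpha < 1)
  (indep_Z : mutually_independent Z)
  (normal_Z : forall t, standard_normal (Z t))
  (c_gt0 : forall T, (0 < T)%N -> 0 < c T)
  (c_infty : c T @[T --> \oo] --> +oo)
  (slope : forall T, (0 < T)%N -> exists u h : R,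
     [/\ (u, h) \in G T,
         `[u - h, u + h] `<=` `[0, 1] &
         (forall w, w \in `[u - h, u + h] ->
            c T * Num.sqrt (ln T%:R / (T%:R * h ^+ 3)) <= m' T w) \/
         (forall w, w \in `[u - h, u + h] ->
            c T * Num.sqrt (ln T%:R / (T%:R * h ^+ 3)) <= - m' T w)]) :
  P [set w | Psi_hat K G sigma2_hat m eps T w <= quantile P' (Phi K G Z T) (1 - alpha)]
    @[T --> \oo] --> 0%E.
Proof.
set sigma2 := long_run_variance eps.
have [Cd [t0 dep0]] : exists Cd t0, (dependence_tail q filt eta eta' t0 <= Cd%:E)%E.
  have [C' hC'] := dep_eps; near \oo => t0.
  have h : (dependence_tail q filt eta eta' t0 <=
      (C' * (t0%:R `^ (- tau q) * ln t0%:R `^ (- A)))%:E)%E by near: t0.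
  by exists (C' * (t0%:R `^ (- tau q) * ln t0%:R `^ (- A))), t0.
have [Cv Cv0 noise] := noise_second_moment mean_eps meas_filt eps_filt q_gt4 mom_eps
  copy_eta dep0.
have [kap kap0 [c0 c00 signal]] := signal_lower_bound kernel_K.
have [Cq Cq0 quant] := quantile_Phi_bound K indep_Z normal_Z grid_nonempty theta_gt0
  alpha_gt0 card_grid.
have q0 : 0 < q by lra.
have eff := effective_sample_size q0 hmin_rate.
have /prob_cvg0 hatP := hat_consistent 1 ltr01.
apply/prob_cvg0 => e e0.
have e2 : 0 < e / 2 by rewrite divr_gt0.
have rhoP : \forall T \near \oo, rho T <= sigma2 / 2.
  have /eqoP/(_ (sigma2 / 2)) := rho_rate; rewrite divr_gt0 // => /(_ isT) hr.
  near=> T.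
  have T0 : (0 < T)%N by near: T; exact: nbhs_infty_gt.
  have lT : 1 <= ln T%:R :> R by near: T; exact: ln_nat_ge.
  have : `|rho T : R^o| <= sigma2 / 2 * `|(ln T%:R)^-1 : R^o| by near: T.
  have li0 : 0 < (ln T%:R : R)^-1 by rewrite invr_gt0 (lt_le_trans ltr01).
  rewrite (gtr0_norm (rho_gt0 T T0)) (gtr0_norm li0).
  move=> /le_trans; apply; rewrite ger_pMr ?divr_gt0 // invf_le1 //.
  exact: lt_le_trans lT.
(* an upper bound for the estimated standard deviation on the event of consistency *)
pose sg := Num.sqrt (2 * sigma2).
have sg0 : 0 < sg by rewrite sqrtr_gt0 mulr_gt0.
near=> T.
have T0 : (0 < T)%N by near: T; exact: nbhs_infty_gt.
have TR : 0 < T%:R :> R by rewrite ltr0n.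
have hatT : (P [set w | (1 < `|(estimate sigma2_hat m eps T w - sigma2) / rho T|)%R]
    <= (e / 2)%:E)%E by near: T; exact: (hatP (e / 2) e2).
have lT : Num.max 1 c0 <= ln T%:R :> R by near: T; exact: ln_nat_ge.
have lT1 : 1 <= ln T%:R :> R by apply: le_trans lT; rewrite le_max lexx.
have l0 : 0 < ln T%:R :> R by exact: lt_le_trans lT1.
have Thm : ln T%:R <= T%:R * hmin T by near: T.
pose L := Num.sqrt (ln T%:R : R).
have L1 : 1 <= L by rewrite -[1]sqrtr1 ler_wsqrtr.
have L0 : 0 < L by exact: lt_le_trans L1.
have [u [h [uhG uh01 slp]]] := slope T T0.
have [_ /=] := grid_sub T (u, h) T0 uhG; rewrite in_itv /= => /andP[hmin_h h_hmax].
have Th : ln T%:R <= T%:R * h by rewrite (le_trans Thm) // ler_pM2l.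
have h0 : 0 < h by rewrite -(pmulr_rgt0 _ TR) (lt_le_trans l0).
have Thc : c0 <= T%:R * h by apply: le_trans Th; apply: le_trans lT; rewrite le_max lexx orbT.
have cT := c_gt0 T T0.
pose B := c T * Num.sqrt (ln T%:R / (T%:R * h ^+ 3)).
have B0 : 0 <= B by rewrite mulr_ge0 ?sqrtr_ge0 // ltW.
have BE : B * h * Num.sqrt (T%:R * h) = c T * L.
  rewrite /B -!mulrA; congr (_ * _).
  rewrite -[X in _ * (X * _)](gtr0_norm h0) -sqrtr_sqr -!sqrtrM ?sqr_ge0 //.
    by congr Num.sqrt; field; rewrite !gt_eqF.
  by rewrite divr_ge0 ?(ltW l0) // mulr_ge0 ?(ltW TR) // exprn_ge0 // ltW.
pose sig := linear_stat K T (fun t => m T (t%:R / T%:R)) u h.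
have sigL : kap * (c T * L) <= `|sig|.
  rewrite -BE; case: slp => slp.
    exact: le_trans (signal T u h _ _ B T0 h0 uh01 Thc (m_C1 T T0) B0 slp) (ler_norm _).
  have := signal T u h _ _ B T0 h0 uh01 Thc (C1_on_unitN (m_C1 T T0)) B0 slp.
  rewrite (linear_statN K T (fun t => m T (t%:R / T%:R))) -/sig => /le_trans; apply.
  by rewrite -normrN ler_norm.
have [noise2 noiseE] := noise (index_iota 1 T.+1) (fun t => weight K T t u h) (iota_uniq _ _).
pose N w := linear_stat K T (fun t => eps t%:Z w) u h.
have NE : Ex P (fun w => N w ^+ 2) <= Cv.
  apply: (le_trans noiseE); rewrite ger_pMr //; exact: weight_sq_le1.
pose x := kap * (c T * L) / 2.
have x0 : 0 < x.
  have cL : 0 < c T * L by rewrite mulr_gt0.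
  by rewrite divr_gt0 // mulr_gt0.
(* the first bound makes the noise exceed half the signal with probability below [e / 2],
   the second one makes half the signal exceed the critical value and the correction *)
have cbig : Num.max ((1 + Cv / (e / 2)) * 2 / kap) ((Cq + 2) * (2 * sg) / kap + 2 / kap) <= c T.
  by near: T; move/cvgryPge : c_infty; apply.
have [cb1 cb2] : (1 + Cv / (e / 2)) * 2 / kap <= c T /\
    (Cq + 2) * (2 * sg) / kap + 2 / kap <= c T.
  by move: cbig; rewrite ge_max => /andP.
have quT : quantile P' (Phi K G Z T) (1 - alpha) <= Cq * Num.sqrt (ln T%:R).
  by near: T; exact: quant.
rewrite -/L in quT.
have mest : measurable_fun setT (estimate sigma2_hat m eps T).
  apply: (@measurableT_comp _ _ _ _ _ _ (sigma2_hat T)); first exact: meas_hat.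
  apply/measurable_fun_tnthP => i.
  rewrite (_ : _ \o _ = fun w => observation m eps T i.+1 w); last first.
    by apply/funext => w /=; rewrite tnth_mktuple.
  by apply: measurable_funD.
set q1 := quantile _ _ _ in quT *.
have mPsi : measurable [set w | Psi_hat K G sigma2_hat m eps T w <= q1].
  apply: measurable_multiscale_le; first exact: grid_nonempty.
    apply: measurableT_comp mest; apply: continuous_measurable_fun.
    exact: sqrt_continuous.
  by move=> t; apply: measurable_funD.
pose A1 := [set w | 1 < `|(estimate sigma2_hat m eps T w - sigma2) / rho T|].
pose A2 := [set w | x < `|N w|].
have mA1 : measurable A1.
  by apply: measurable_abs_gt; apply: measurable_funM => //; exact: measurable_funB.
have mA2 : measurable A2 by apply: measurable_abs_gt; case: noise2.
have PA1 : (P A1 <= (e / 2)%:E)%E by [].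
have PA2 : (P A2 <= (e / 2)%:E)%E.
  apply: (le_trans (markov_sq x0 noise2)); rewrite lee_fin.
  rewrite ler_pdivrMr ?exprn_gt0 //; apply: (le_trans NE).
  rewrite mulrC -ler_pdivrMr //.
  have cb3 : (1 + Cv / (e / 2)) * 2 <= c T * kap by rewrite -ler_pdivrMr.
  have z0 : 0 <= Cv / (e / 2) by rewrite divr_ge0 ?ltW.
  have xz : 1 + Cv / (e / 2) <= x.
    have ck : 0 <= kap * c T by rewrite mulr_ge0 ?ltW.
    by have := ler_wpM2l ck L1; rewrite /x; lra.
  have x1 : 1 <= x by lra.
  have : x <= x ^+ 2 by rewrite expr2 ler_peMr // ltW.
  lra.
have rhoT : rho T <= sigma2 / 2 by near: T.
(* without a rejection, the variance estimate is bad or the noise exceeds half the signal *)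
have sub : [set w | Psi_hat K G sigma2_hat m eps T w <= q1] `<=` A1 `|` A2.
  move=> w /= Psi_le; apply: contrapT => /not_orP[nA1 nA2].
  have estw : `|estimate sigma2_hat m eps T w - sigma2| <= sigma2 / 2.
    apply: le_trans rhoT; move: nA1 => /negP; rewrite -leNgt normrM normfV.
    by rewrite (gtr0_norm (rho_gt0 T T0)) ler_pdivrMr ?(rho_gt0 T T0) // mul1r.
  have Nw : `|N w| <= x by move: nA2 => /negP; rewrite -leNgt.
  move: Psi_le; rewrite leNgt => /negP; apply.
  pose sd := Num.sqrt (estimate sigma2_hat m eps T w).
  have [e1 e2'] : sigma2 / 2 <= estimate sigma2_hat m eps T w /\
      estimate sigma2_hat m eps T w <= 2 * sigma2.
    by move: estw lrv_gt0; rewrite -/sigma2 ler_norml => /andP[]; split; lra.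
  have sd0 : 0 < sd by rewrite sqrtr_gt0 (lt_le_trans _ e1) // divr_gt0.
  have sdsg : sd <= sg by rewrite ler_wsqrtr.
  have stat : x <= `|linear_stat K T (fun t => observation m eps T t w) u h|.
    rewrite (linear_statD K T (fun t => m T (t%:R / T%:R)) (fun t => eps t%:Z w)) -/sig -/(N w).
    have := ler_normB (sig + N w) (N w); rewrite addrK /x; rewrite /x in Nw; lra.
  have lamL : lambda_ h <= 2 * L.
    have -> : 2 * L = Num.sqrt (2 ^+ 2 * ln T%:R).
      by rewrite sqrtrM ?sqr_ge0 // sqrtr_sqr ger0_norm.
    rewrite /lambda_ ler_wsqrtr //.
    have h2 : 0 < 2 * h by rewrite mulr_gt0.
    have : ln (1 / (2 * h)) <= ln T%:R.
      rewrite ler_ln ?posrE ?divr_gt0 // ler_pdivrMr //; lra.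
    lra.
  apply: (le_lt_trans quT).
  apply: (lt_le_trans _ (multiscale_stat_ge _ _ _ _ uhG)).
  rewrite normrM normfV -/sd (gtr0_norm sd0) ltrBrDr.
  apply: (@lt_le_trans _ _ (x / sg)); last first.
    apply: ler_pM => //; rewrite ?(ltW x0) ?invr_ge0 ?(ltW sg0) //.
    by rewrite lef_pV2 ?posrE.
  rewrite ltr_pdivlMr //.
  have ck : (Cq + 2) * (2 * sg) + 2 <= kap * c T.
    rewrite -(ler_pM2l kap0) in cb2; apply: le_trans cb2.
    by rewrite le_eqVlt; apply/orP; left; apply/eqP; field; rewrite gt_eqF.
  have h1 := ler_wpM2r (ltW L0) ck.
  have h2 : (Cq * L + lambda_ h) * sg <= (Cq * L + 2 * L) * sg.
    by rewrite ler_pM2r // lerD2l.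
  apply: (le_lt_trans h2); rewrite /x.
  by rewrite ltr_pdivlMr //; move: h1 L0; clear; lra.
apply: (le_trans (le_measure P _ _ sub)); rewrite ?inE //; first exact: measurableU.
apply: (le_trans (measureU2 _ mA1 mA2)).
by rewrite [e]splitr EFinD leeD.
Unshelve. all: by end_near. Qed.
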